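(* Let $G$ be a finite simple group of Lie type whose defining characteristic is $p$, with its standard split $BN$-pair $(B,N)$, $B=H\ltimes U$, where $U$ is a Sylow $p$-subgroup of $G$. Let $n_0\in N$ be a representative of the longest element $w_0$ of the Weyl group $W=N/H$ and set $U^{-}:=U^{n_0}=n_0^{-1}Un_0$. Then $G=(UU^{-})^{2}=UU^{-}UU^{-}$. Moreover, $G=UU^{-}U$ if and only if $U$ is a Carter subgroup of $G$ (i.e. $N_G(U)=U$). In both cases these factorizations have minimal length: the smallest $k$ such that $G$ is a product of $k$ conjugates of $U$ equals $3$ if $U$ is a Carter subgroup of $G$, and equals $4$ otherwise.
   Context: Products of subsets of a group are setwise products. For a subgroup $A\le G$ and $g\in G$, $A^g=g^{-1}Ag$. A Carter subgroup of a finite group is a nilpotent self-normalizing subgroup. A split $BN$-pair $(H,U,N)$ for $G$ means that $B=H\ltimes U$ and $N$ form a $BN$-pair of $G$ with $H=B\cap N$, satisfying the axioms of split $BN$-pairs (as in Carter, Finite Groups of Lie Type, \S 2.5). *)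

(* Defs.v *)
From HB Require Import structures.
From mathcomp Require Import all_boot all_fingroup all_solvable.
Set Implicit Arguments. Unset Strict Implicit. Unset Printing Implicit Defensive.
Import GroupScope.
Open Scope group_scope.

Section Defs.
Variable gT : finGroupType.

Definition has_len (H : {set gT}) (S : {set coset_of H}) (w : coset_of H) (k : nat) :=
  exists ss : seq (coset_of H), [/\ size ss = k, all (mem S) ss & w = \prod_(s <- ss) s].

Definition longest_elt (H : {set gT}) (S : {set coset_of H}) (W : {set coset_of H})
    (w0 : coset_of H) :=
  w0 \in W /\
  exists L, [/\ has_len S w0 L, (forall k, k < L -> ~ has_len S w0 k)
              & forall w, w \in W -> exists2 k, k <= L & has_len S w k].

(* (B,N) is a BN-pair (Tits system) of G with Weyl group N/H, H = B :&: N,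
   Coxeter generating set S; split of characteristic p in the sense of
   Carter, Finite Groups of Lie Type, 2.5: B = U H, U normal p-subgroup of B,
   H an abelian p'-complement, and the intersection of the N-conjugates of B is H. *)
Definition split_BN_pair (p : nat) (G B N H U : {group gT}) (S : {set coset_of H}) :=
  [/\ [/\ G :=: <<B :|: N>>, H :=: B :&: N, H <| N,
          S \subset N / H & <<S>> = N / H ],
      [/\ forall s, s \in S -> #[s] = 2,
          (forall s n, s \in N -> coset H s \in S -> n \in N ->
             (s *: B) :* n \subset (B :* n * B) :|: (B :* (s * n) * B))
        & forall s, s \in N -> coset H s \in S -> (s *: B) :* s != B ],
      [/\ U <| B, U * H = B, U :&: H = 1, p.-group U & abelian H ],
      p^'.-group H &
      \bigcap_(n in N) (B :^ n) = H ].

Definition carter (G U : {group gT}) :=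
  [/\ U \subset G, nilpotent U & 'N_G(U) = U].

Definition conj_prod_cover (G U : {group gT}) (k : nat) :=
  exists gs : seq gT, [/\ size gs = k, all (mem G) gs &
                          \prod_(g <- gs) (U :^ g) = G].

Definition min_conj_prod (G U : {group gT}) (k : nat) :=
  conj_prod_cover G U k /\ forall j, j < k -> ~ conj_prod_cover G U j.

End Defs.
Arguments split_BN_pair [gT] p G B N H U S.

(* Main.v *)
Require Import Defs.
From mathcomp Require Import all_boot all_fingroup all_algebra all_solvable all_field.
From mathcomp Require Import all_character.
Set Implicit Arguments. Unset Strict Implicit. Unset Printing Implicit Defensive.
Import GRing.Theory GroupScope.
Open Scope group_scope.

(** Write E_n = U n U. In a split BN-pair G is the disjoint union of the E_n, n in N,
    and E_r E_n = E_(rn) whenever the length grows. For a reflection r put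
    K_r = <U, U^r>, T_r = H /\ K_r and M_r = (N /\ K_r) \ H = m T_r. The heart of the
    proof is the rank one fact that m U m meets E_(mh) for every h in T_r. It is proved
    by Fourier analysis in characteristic p: for h in T_r let c(h) be the number, mod p,
    of nontrivial cosets uD (D = U /\ mUm^-1) with mum in E_(mh). If the transform of c
    at a character th of T_r is nonzero, then th extends to a character of K_r trivial on
    the p-elements, so th = 1; hence c is constant, and it is nonzero since its sum
    is |U : D| - 1.

    Along a reduced expression of n0^-1 this makes E_(n0^-1) E_(n0) absorb the product of
    all the T_r, so it contains (prod T_r) n0; simplicity of G forces H = prod T_r, whence
    G = E_(n0^-1) E_(n0) E_(n0^-1). Conversely E_n E_n' meets H in at most one point, so
    three conjugates of U suffice only if H = 1, that is, only if U is self-normalizing. *)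

(** * Fourier inversion with values in a finite field *)

Section Fourier.
Local Open Scope ring_scope.
Variables (gT : finGroupType) (F : finFieldType) (L : {group gT}).
Hypotheses (cLL : abelian L) (expLF : forall h, h \in L -> (h ^+ #|F|)%g = h).

(** Each [rG h] is a root of ['X^#|F| - 'X], which splits over [F] with simple roots, and commuting
    diagonalizable matrices have a common eigenbasis. *)
Lemma repr_codiagonalizable n (rG : mx_representation F L n) :
  exists2 P : 'M[F]_n, P \in unitmx & forall h, h \in L -> is_diag_mx (P *m rG h *m invmx P).
Proof.
case: n rG => [|n] rG.
  by exists 1%:M; rewrite ?unitmx1 // => h _; apply/is_diag_mxP => -[].
case: (codiagonalizableP [seq rG h | h in L]) => + _.
case=> [|P uP /allP dP]; last first.
  exists P => // h Lh; have := dP (rG h); rewrite /= /similar_to conjumx //.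
  by apply; apply: image_f.
split=> [f g /imageP[x Lx ->] /imageP[y Ly ->]|f /imageP[x Lx ->]].
  by rewrite /comm_mx -!repr_mxM // (centsP cLL).
apply/diagonalizableP; exists (enum F); first exact: enum_uniq.
rewrite big_enum /= -finField_genPoly; apply: mxminpoly_min.
by rewrite rmorphB rmorphXn /= horner_mx_X -repr_mxX // expLF // subrr.
Qed.

(** In a common eigenbasis of the regular representation, the matrix [Cm] has transforms of [c] as
    diagonal entries. If those at nontrivial characters vanish, [Cm] absorbs every [rG h], and
    comparing coefficients makes [c] constant. *)
Lemma fun_eq_cst_of_characters (c : gT -> F) :
  (forall th : gT -> F, th 1%g = 1 -> {in L &, {morph th : x y / (x * y)%g >-> x * y}} ->
     (exists2 h, h \in L & th h != 1) -> \sum_(h in L) c h * th h = 0) ->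
  forall h, h \in L -> c h = c 1%g.
Proof.
move=> chars h Lh; pose rG := regular_repr F L.
have [P uP dP] := repr_codiagonalizable rG.
pose D a := P *m rG a *m invmx P.
pose d a i := D a i i.
have dM i : {in L &, {morph d^~ i : x y / (x * y)%g >-> x * y}}.
  move=> x y Lx Ly; rewrite /d (_ : D (x * y)%g = D x *m D y); last first.
    by rewrite /D repr_mxM // !mulmxA mulmxKV.
  rewrite mxE (bigD1 i) //= big1 ?addr0 // => j ji.
  by have /is_diag_mxP -> := dP x Lx; rewrite ?mul0r // eq_sym.
have d1 i : d 1%g i = 1 by rewrite /d /D repr_mx1 mulmx1 mulmxV // mxE eqxx.
pose Cm := \sum_(a in L) c a *: rG a.
(* On each eigenvector either the character is 1 at [h], so that [D h - 1%:M] vanishes there, or it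
   is nontrivial and the transform [s] is 0. *)
have CmD : Cm *m (rG h - 1%:M) = 0.
  have E : Cm *m (rG h - 1%:M) = invmx P *m ((\sum_(a in L) c a *: D a) *m (D h - 1%:M)) *m P.
    have -> : D h - 1%:M = P *m (rG h - 1%:M) *m invmx P.
      by rewrite mulmxBr mulmxBl mulmx1 mulmxV.
    have -> : \sum_(a in L) c a *: D a = P *m Cm *m invmx P.
      rewrite mulmx_sumr mulmx_suml; apply: eq_bigr => a _.
      by rewrite -scalemxAr -scalemxAl.
    by rewrite !mulmxA mulVmx // mul1mx !mulmxKV.
  rewrite E; set X := _ *m (D h - _); suff -> : X = 0 by rewrite mulmx0 mul0mx.
  apply/matrixP=> i j; rewrite [RHS]mxE /X mxE.
  pose s := \sum_(a in L) c a * d a i.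
  have SD k : (\sum_(a in L) c a *: D a) i k = s *+ (i == k).
    rewrite summxE -sumrMnl; apply: eq_bigr => a La; rewrite mxE.
    have [<-|ik] := eqVneq i k; first by rewrite mulr1n.
    by have /is_diag_mxP -> := dP a La; rewrite ?mulr0.
  under eq_bigr => k _ do rewrite SD.
  rewrite (bigD1 i) //= big1 => [|k ki]; last by rewrite eq_sym (negPf ki) mul0r.
  rewrite addr0 eqxx.
  rewrite mulr1n [X in _ * X]mxE [X in _ + X]mxE [X in - X]mxE.
  have [<-|ij] := eqVneq i j; last first.
    by rewrite [D h i j](is_diag_mxP (dP h Lh)) // subrr mulr0.
  have [->|nt] := eqVneq (D h i i) 1; first by rewrite subrr mulr0.
  by rewrite /s (chars (d^~ i)) ?mul0r //; exists h.
(* [e1] is the basis vector of the identity of [L]. Applied to it, [Cm *m rG h = Cm] reads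
   [c 1 = c h] in the coordinate of [h]. *)
pose e1 : 'rV[F]_#|L| := delta_mx 0 (gring_index L 1).
have e1G a : a \in L -> e1 *m rG a = delta_mx 0 (gring_index L a).
  by move=> La; rewrite -rowE rowK gring_indexK ?group1 // mul1g.
move/eqP: CmD; rewrite mulmxBr mulmx1 subr_eq0 => /eqP/(congr1 (mulmx e1)).
move/matrixP/(_ 0 (gring_index L h)) => +; rewrite mulmxA mulmx_sumr mulmx_suml !summxE.
rewrite (bigD1 1%g) //= big1 ?addr0; last first.
  move=> a /andP[La a1]; rewrite -scalemxAr -scalemxAl -mulmxA -repr_mxM // e1G ?groupM //.
  rewrite !mxE /= (inj_in_eq (can_in_inj (@gring_indexK _ L))) ?groupM //.
  by rewrite -{1}[h]mul1g (inj_eq (mulIg _)) eq_sym (negPf a1) mulr0.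
rewrite (bigD1 h) //= big1 ?addr0; last first.
  move=> a /andP[La a1]; rewrite -scalemxAr e1G //.
  rewrite !mxE /= (inj_in_eq (can_in_inj (@gring_indexK _ L))) //.
  by rewrite eq_sym (negPf a1) mulr0.
rewrite -!scalemxAr -scalemxAl -mulmxA -repr_mxM // mul1g !e1G // !mxE !eqxx !mulr1.
by move->.
Qed.
End Fourier.

(** * Double cosets of a subgroup *)

Section DoubleCosets.
Variables (gT : finGroupType) (A : {group gT}).
Implicit Types g n a : gT.

Definition dcoset n : {set gT} := A :* n * A.

Lemma dcosetP n g :
  reflect (exists a b, [/\ a \in A, b \in A & g = a * n * b]) (g \in dcoset n).
Proof.
apply: (iffP mulsgP) => [[x b /rcosetP[a Aa ->] Ab ->]|[a [b [Aa Ab ->]]]].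
  by exists a, b.
by exists (a * n) b; rewrite // mem_rcoset mulgK.
Qed.

Lemma dcoset_id n : n \in dcoset n.
Proof. by apply/dcosetP; exists 1, 1; rewrite group1 mul1g mulg1. Qed.

Lemma mem_dcosetl a n g : a \in A -> (a * g \in dcoset n) = (g \in dcoset n).
Proof.
move=> Aa; apply/dcosetP/dcosetP=> [[x [y [Ax Ay e]]]|[x [y [Ax Ay ->]]]].
  by exists (a^-1 * x), y; rewrite groupM ?groupV // -2!mulgA (mulgA x) -e mulKg.
by exists (a * x), y; rewrite groupM // !mulgA.
Qed.

Lemma mem_dcosetr a n g : a \in A -> (g * a \in dcoset n) = (g \in dcoset n).
Proof.
move=> Aa; apply/dcosetP/dcosetP=> [[x [y [Ax Ay e]]]|[x [y [Ax Ay ->]]]].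
  by exists x, (y * a^-1); rewrite groupM ?groupV // mulgA -e mulgK.
by exists x, (y * a); rewrite groupM // !mulgA.
Qed.

Lemma dcoset_sym n g : (g \in dcoset n) = (n \in dcoset g).
Proof.
suff h x y : x \in dcoset y -> y \in dcoset x by apply/idP/idP => /h.
case/dcosetP=> a [b [Aa Ab ->]]; apply/dcosetP; exists a^-1, b^-1.
by rewrite !groupV; split=> //; rewrite !mulgA mulVg mul1g mulgK.
Qed.

Lemma dcoset_trans n x g : x \in dcoset n -> g \in dcoset x -> g \in dcoset n.
Proof.
by move=> nx /dcosetP[a [b [Aa Ab ->]]]; rewrite mem_dcosetr // mem_dcosetl.
Qed.

Lemma dcoset_inv n g : (g^-1 \in dcoset n^-1) = (g \in dcoset n).
Proof.
suff h x y : x \in dcoset y -> x^-1 \in dcoset y^-1.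
  by apply/idP/idP=> /h; rewrite ?invgK.
case/dcosetP=> a [b [Aa Ab ->]]; apply/dcosetP; exists b^-1, a^-1.
by rewrite !groupV !invMg !mulgA.
Qed.

End DoubleCosets.

(** * Rank one: the group generated by [U] and [U :^ m] *)

Section RankOne.
Variables (gT : finGroupType) (p : nat) (U L K : {group gT}) (m : gT).
Hypotheses (pr_p : prime p) (pU : p.-group U).
Hypotheses (cLL : abelian L) (pL : p^'.-group L) (nUL : L \subset 'N(U)).
Hypotheses (nLm : m \in 'N(L)) (m2L : m * m \in L) (mK : m \in K) (sLK : L \subset K).
Hypothesis genK : K :=: <<U :|: U :^ m>>.
Hypothesis cellsK : forall g, g \in K ->
  g \in U * L \/ exists2 h, h \in L & g \in dcoset U (m * h).
Hypothesis cells_disj : forall h, h \in L -> m * h \notin U * L.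
Hypothesis cells_inj : forall h h', h \in L -> h' \in L ->
  m * h' \in dcoset U (m * h) -> h = h'.
Hypothesis nontriv : exists2 u, u \in U & u ^ m \notin U.

Notation E := (dcoset U).
Notation D := (U :&: U :^ m^-1).
Implicit Types g x u h d : gT.

Let UK u : u \in U -> u \in K.
Proof. by move=> Uu; rewrite genK mem_gen // inE Uu. Qed.
Let LK h : h \in L -> h \in K. Proof. exact: (subsetP sLK). Qed.
Let UL1 : U :&: L = 1.
Proof. exact/coprime_TIg/(pnat_coprime pU). Qed.
Let UJ h u : h \in L -> (u ^ h \in U) = (u \in U).
Proof. by move=> Lh; rewrite memJ_norm // (subsetP nUL). Qed.
Let LJ h : (h ^ m \in L) = (h \in L).
Proof. by rewrite memJ_norm. Qed.
Let ULE : U * L = U <*> L. Proof. by rewrite norm_joinEr. Qed.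
Let hallU : p.-Hall(U <*> L) U.
Proof.
rewrite /pHall joing_subl pU -divgS ?joing_subl //=.
by rewrite norm_joinEr // TI_cardMg // mulKn.
Qed.
Let pelt u g : u \in U -> u ^ g \in U * L -> u ^ g \in U.
Proof.
move=> Uu; rewrite ULE => ULu; rewrite (mem_normal_Hall hallU) //.
  by rewrite p_eltJ (mem_p_elt pU).
by rewrite normalYl.
Qed.
Let ULP u h : u \in U -> h \in L -> u * h \in U * L.
Proof. exact: mem_mulg. Qed.
Let UUL u : u \in U -> u \in U * L.
Proof. by move=> Uu; rewrite -[u]mulg1 ULP. Qed.
Let LUL h : h \in L -> h \in U * L.
Proof. by move=> Lh; rewrite -[h]mul1g ULP. Qed.
Let ULMl x y : x \in U * L -> (x * y \in U * L) = (y \in U * L).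
Proof. by rewrite ULE => ULx; rewrite groupMl. Qed.
Let ULMr x y : x \in U * L -> (y * x \in U * L) = (y \in U * L).
Proof. by rewrite ULE => ULx; rewrite groupMr. Qed.

Let Emh_UL h g : h \in L -> g \in E (m * h) -> g \notin U * L.
Proof.
move=> Lh /dcosetP[a [b [Ua Ub ->]]].
by rewrite (ULMr _ (UUL Ub)) (ULMl _ (UUL Ua)) cells_disj.
Qed.

(* The h with g in E (m * h); the junk value 1 outside those cells. *)
Definition lpart g := odflt 1 [pick h in L | g \in E (m * h)].

Let lpart_in g : lpart g \in L.
Proof. by rewrite /lpart; case: pickP => [h /andP[]|_] //=; rewrite group1. Qed.

Let lpartE h g : h \in L -> g \in E (m * h) -> lpart g = h.
Proof.
move=> Lh Eg; rewrite /lpart; case: pickP => [h' /andP[Lh' Eg']|/(_ h)] /=.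
  by apply: cells_inj => //; apply: (dcoset_trans Eg'); rewrite dcoset_sym.
by rewrite Lh Eg.
Qed.

Let cellK g : g \in K -> g \notin U * L -> g \in E (m * lpart g).
Proof.
move=> Kg nULg; have [ULg|[h Lh Eg]] := cellsK Kg; first by rewrite ULg in nULg.
by rewrite (lpartE Lh Eg).
Qed.

Let DJ d : d \in D -> d ^ m \in U.
Proof. by rewrite inE mem_conjgV => /andP[]. Qed.

(** [m * u * m] is [u ^ m^-1] times an element of [L], and a conjugate of [u] in [U * L] is a
    [p]-element, so it lies in [U]. Conjugation by [m * m], which normalizes [U], turns [u ^ m^-1]
    into [u ^ m]. *)
Let mDm u : u \in U -> (m * u * m \in U * L) = (u \in D).
Proof.
move=> Uu; have -> : m * u * m = u ^ m^-1 * (m * m) by rewrite /conjg invgK !mulgA mulgKV.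
rewrite (ULMr _ (LUL m2L)) inE Uu mem_conjgV /=; apply/idP/idP=> [ULu|Uum].
  have {}ULu := pelt Uu ULu.
  rewrite -(UJ _ m2L) in ULu; move: ULu.
  by rewrite -conjgM mulgA mulVg mul1g.
apply/UUL; rewrite -(UJ _ m2L) -conjgM mulgA mulVg mul1g //.
Qed.

Let DJL h : h \in L -> D :^ h = D.
Proof.
move=> Lh; have nUh k : k \in L -> U :^ k = U by move=> Lk; rewrite (normsP nUL).
rewrite conjIg nUh // -conjsgM; congr (_ :&: _).
have -> : m^-1 * h = h ^ m * m^-1 by rewrite /conjg !mulgA mulgK.
by rewrite conjsgM nUh ?LJ.
Qed.

Let lcosetsMJ u h X : u \in U -> h \in L -> X \in lcosets D U ->
  (u *: X) :^ h \in lcosets D U.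
Proof.
move=> Uu Lh /lcosetsP[v Uv ->]; apply/lcosetsP; exists ((u * v) ^ h).
  by rewrite UJ ?groupM.
by rewrite -lcosetM conjsMg conjg_set1 DJL.
Qed.

Local Ltac memK :=
  repeat match goal with |- is_true (_ \in _) =>
    first [assumption | by apply: UK | by apply: LK | apply: groupM | apply: groupVr] end.

Let in_lcoset X a b : X \in lcosets D U -> a \in X -> b \in X ->
  a \in U /\ exists2 d, d \in D & b = (a * d).
Proof.
case/lcosetsP=> v Uv -> /lcosetP[d Dd ->] /lcosetP[d' Dd' ->].
split; first by rewrite groupM //; case/setIP: Dd.
exists (d^-1 * d'); first by rewrite groupM ?groupV.
by rewrite mulgA mulgK.
Qed.

Let repr_lcoset X : X \in lcosets D U -> repr X \in X.
Proof. by case/lcosetsP=> v Uv ->; apply: (mem_repr v); apply: lcoset_refl. Qed.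

Let repr_U X : X \in lcosets D U -> repr X \in U.
Proof. by move=> XX; case: (in_lcoset XX (repr_lcoset XX) (repr_lcoset XX)). Qed.

Let DinDU : (D : {set gT}) \in lcosets D U.
Proof. by apply/lcosetsP; exists 1; rewrite ?mul1g // lcoset1. Qed.

Let lcoset_cell X : X \in lcosets D U -> X != D ->
  (m * repr X * m) \in E (m * lpart (m * repr X * m)).
Proof.
move=> XX nXD; have UX := repr_U XX; apply: cellK; first by memK.
rewrite mDm //; apply: contra nXD => Dr.
case/lcosetsP: XX (repr_lcoset XX) Dr => v Uv -> /lcosetP[d Dd ->] Dvd.
by rewrite (lcoset_id (_ : v \in D)) // -(groupMr _ Dd).
Qed.

(** By [nontriv], [D] is proper in the [p]-group [U]. Hence a constant sums to 0 over all cosets in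
    characteristic [p], and the cosets other than [D] count as -1. *)
Let p_dvd_lcosets : p %| #|lcosets D U|.
Proof.
rewrite card_lcosets; have [u Uu nUu] := nontriv.
have ne1 : #|U : D| != 1%N.
  by rewrite indexg_eq1; apply: contra nUu => /subsetP/(_ u Uu)/DJ.
have := pnat_dvd (dvdn_indexg U D) pU => /p_natP[[|k] e]; first by rewrite e in ne1.
by rewrite e expnS dvdn_mulr.
Qed.

(** * Extending a character of [L] to [K] through the kernel of a Hecke operator *)

Section Character.
Local Open Scope ring_scope.
Variables (F : finFieldType) (chF : p \in [pchar F]).
Variable th : gT -> F.
Hypotheses (th1 : th 1%g = 1)
  (thM : {in L &, {morph th : x y / (x * y)%g >-> x * y}}).

(** The Fourier coefficient at [th] of the function that counts the nontrivial cosets [u D] by the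
    cell of [m * u * m]. *)
Definition chat : F := \sum_(X in lcosets D U :\ (D : {set gT})) th (lpart (m * repr X * m)%g).

Hypothesis chat_nz : chat != 0.

(* The factor on the big cell is the one that makes [hecke ext] vanish at m. *)
Definition ext (g : gT) : F :=
  if g \in (U * L)%g then th (remgr U L g)
  else if g \in K then - th (m * m)%g / chat * th (lpart g) else 0.

Notation al := (- th (m * m)%g / chat).

Let extB u h : u \in U -> h \in L -> ext (u * h)%g = th h.
Proof. by move=> Uu Lh; rewrite /ext ULP // remgrMid. Qed.

Let extM u h u' : u \in U -> h \in L -> u' \in U -> ext (u * (m * h) * u')%g = al * th h.
Proof.
move=> Uu Lh Uu'; have Eg : (u * (m * h) * u')%g \in E (m * h)%g by apply/dcosetP; exists u, u'.
rewrite /ext (negPf (Emh_UL Lh Eg)) (lpartE Lh Eg) ifT //; memK.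
Qed.

Let cellsP (P : gT -> Prop) :
  (forall u h, u \in U -> h \in L -> P (u * h)%g) ->
  (forall u h u', u \in U -> h \in L -> u' \in U -> P (u * (m * h) * u')%g) ->
  forall g, g \in K -> P g.
Proof.
move=> PB PM g /cellsK[/mulsgP[u h Uu Lh ->]|[h Lh /dcosetP[u [u' [Uu Uu' ->]]]]].
  exact: PB.
exact: PM.
Qed.

Let ext_l u g : u \in U -> g \in K -> ext (u * g)%g = ext g.
Proof.
move=> Uu; move: g; apply: cellsP => [v h Uv Lh|v h v' Uv Lh Uv'].
  by rewrite mulgA !extB ?groupM.
by rewrite !mulgA -(mulgA _ m) !extM ?groupM // -[(v * m * h)%g]mulgA extM.
Qed.

Let ext_rU u g : u \in U -> g \in K -> ext (g * u)%g = ext g.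
Proof.
move=> Uu; move: g; apply: cellsP => [v h Uv Lh|v h v' Uv Lh Uv'].
  have -> : (v * h * u = (v * u ^ h^-1) * h)%g by rewrite /conjg invgK !mulgA mulgKV.
  have Uuh : (u ^ h^-1)%g \in U by rewrite UJ ?groupV.
  rewrite (extB Uv Lh) extB //; exact: groupM.
by rewrite -mulgA !extM ?groupM.
Qed.

Let ext_rL h g : h \in L -> g \in K -> ext (g * h)%g = ext g * th h.
Proof.
move=> Lh; move: g; apply: cellsP => [v k Uv Lk|v k v' Uv Lk Uv'].
  by rewrite -mulgA !extB ?groupM // thM.
have -> : (v * (m * k) * v' * h = v * (m * (k * h)) * v' ^ h)%g.
  by rewrite /conjg !mulgA mulgK.
have Uvh : (v' ^ h)%g \in U by rewrite UJ.
by rewrite (extM Uv Lk Uv') extM ?(groupM Lk Lh) // (thM Lk Lh) mulrA.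
Qed.

(** The Hecke operator of the double coset [U m U] on right [U]-invariant functions: the left cosets
    of [U] in it are the [u m U], with [u] modulo [D]. *)
Definition hecke (f : gT -> F) x : F := \sum_(X in lcosets D U) f (x * repr X * m)%g.

(** Reindexing by a permutation [s] of the cosets. As [t (repr X)] need not be the chosen
    representative of [s X], [f] has to be constant on cosets of [D]. *)
Let sum_lcosets (f : gT -> F) (s s' : {set gT} -> {set gT}) (t : gT -> gT) :
    (forall X, s (s' X) = X) -> (forall X, s' (s X) = X) ->
    (forall X, (s X \in lcosets D U) = (X \in lcosets D U)) ->
    (forall (X : {set gT}) x, x \in X -> t x \in s X) ->
    (forall u d, u \in U -> d \in D -> f (u * d)%g = f u) ->
  \sum_(X in lcosets D U) f (t (repr X)) = \sum_(X in lcosets D U) f (repr X).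
Proof.
move=> ss' s's sX tX fD; rewrite [RHS](reindex_onto s s') //.
under [RHS]eq_bigl => X do rewrite s's eqxx andbT sX.
apply: eq_bigr => X XX; have XsX : s X \in lcosets D U by rewrite sX.
have [Ua [d Dd ->]] := in_lcoset XsX (repr_lcoset XsX) (tX _ _ (repr_lcoset XX)).
exact: fD.
Qed.

Let hecke_ext x : x \in K -> hecke ext x = 0.
Proof.
have hl u y : u \in U -> y \in K -> hecke ext (u * y)%g = hecke ext y.
  move=> Uu Ky; apply: eq_bigr => X /repr_U UX; rewrite -!mulgA ext_l //; memK.
move: x; apply: cellsP => [u h Uu Lh|u h u' Uu Lh Uu'].
  rewrite hl /hecke //; last exact: LK.
  (* On the small cell all terms agree, and their number is divisible by [p]. *)
  transitivity (\sum_(X in lcosets D U) al * th (h ^ m)%g).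
    apply: eq_bigr => X XX.
    have -> : (h * repr X * m = repr X ^ h^-1 * (m * h ^ m) * 1)%g.
      by rewrite /conjg invgK !mulgA !mulg1 mulgK mulgKV.
    by rewrite extM ?LJ // UJ ?groupV // repr_U.
  by rewrite sumr_const -mulr_natr (_ : _%:R = 0) ?mulr0 //; apply/eqP; rewrite -(dvdn_pcharf chF).
rewrite -!mulgA hl /hecke //; last by memK.
pose f y := ext (m * y * m)%g.
transitivity (\sum_(X in lcosets D U) f ((u' * repr X) ^ h^-1)%g * th (h ^ m)%g).
  apply: eq_bigr => X /repr_U UX; rewrite -ext_rL ?LJ //.
    by congr (ext _); rewrite /conjg invgK !mulgA mulgK mulgKV.
  by rewrite conjgE; memK.
(* Translation by [u'] followed by conjugation by [h^-1] permutes the cosets; this reduces the sum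
   to the one at [m]. *)
rewrite -mulr_suml (_ : \sum_(X in _) _ = \sum_(X in lcosets D U) f (repr X)); last first.
  apply: (@sum_lcosets f (fun X => (u' *: X) :^ h^-1)%g (fun X => u'^-1 *: (X :^ h))%g
     (fun x => (u' * x) ^ h^-1)%g).
  - by move=> X; rewrite -lcosetM mulgV lcoset1 conjsgK.
  - by move=> X; rewrite conjsgKV -lcosetM mulVg lcoset1.
  - move=> X; apply/idP/idP=> XX; last by rewrite lcosetsMJ ?groupV.
    have := lcosetsMJ (group1 U) Lh XX; rewrite lcoset1 conjsgKV.
    move/(lcosetsMJ (groupVr Uu') (group1 L)).
    by rewrite conjsg1 -lcosetM mulVg lcoset1.
  - by move=> X x xX; rewrite memJ_conjg mem_lcoset mulKg.
  - move=> v d Uv Dd; rewrite /f.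
    have -> : (m * (v * d) * m = m * v * m * d ^ m)%g by rewrite /conjg !mulgA mulgK.
    by rewrite ext_rU ?DJ //; memK.
(* The coset [D] contributes [th (m * m)] and the others together [al * chat], which is its
   opposite. *)
rewrite (bigD1 (D : {set gT})) //= /f.
have -> : ext (m * repr D * m)%g = th (m * m)%g.
  have Dr : repr D \in D by apply: (mem_repr 1%g); apply: group1.
  have -> : (m * repr D * m = repr D ^ m^-1 * (m * m))%g.
    by rewrite /conjg invgK !mulgA mulgKV.
  rewrite extB //; have := DJ Dr; rewrite -(UJ _ m2L) -conjgM.
  by rewrite mulKg.
rewrite (_ : \sum_(X in _ | _) _ = al * chat); last first.
  rewrite /chat mulr_sumr; apply: eq_big => [X|X /andP[XX nXD]].
    by rewrite inE in_set1 andbC.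
  have /dcosetP[a [b [Ua Ub e]]] := lcoset_cell XX nXD.
  by rewrite {1}e extM.
by rewrite divfK // subrr mul0r.
Qed.

(** The kernel of the Hecke operator on the representation induced to [K] from the character of
    [U * L] that extends [th] trivially over [U]. Extension by 0 outside [K] lets members be
    compared on all of [gT]. *)
Definition hecke_kernel (f : gT -> F) :=
  [/\ forall x, x \notin K -> f x = 0,
      {in K & U, forall x u, f (x * u)%g = f x},
      {in K & L, forall x h, f (x * h)%g = f x * th h}
    & forall x, x \in K -> hecke f x = 0].

(** A left [U]-invariant member is determined by its values at 1 and [m]. Given [f 1 = 0], the Hecke
    condition at [m] reads [f m * chat = 0], and [chat] is nonzero. *)
Let hecke_kernel_fixed f : hecke_kernel f -> f 1%g = 0 ->
  {in U & K, forall u x, f (u * x)%g = f x} -> forall x, f x = 0.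
Proof.
case=> f0 fU fL fT f1 fixU.
have fB u h : u \in U -> h \in L -> f (u * h)%g = 0.
  by move=> Uu Lh; rewrite fixU ?LK // -[h]mul1g fL ?group1 // f1 mul0r.
have fM u h u' : u \in U -> h \in L -> u' \in U -> f (u * (m * h) * u')%g = f m * th h.
  move=> Uu Lh Uu'; have K1 : (u * (m * h))%g \in K by memK.
  have K2 : (m * h)%g \in K by memK.
  by rewrite fU // fixU // fL.
have fm0 : f m = 0.
  have := fT m mK; rewrite /hecke (bigD1 (D : {set gT})) //=.
  have Dr : repr D \in D by apply: (mem_repr 1%g); apply: group1.
  have /mulsgP[u h Uu Lh ->] : (m * repr D * m)%g \in (U * L)%g.
    by rewrite mDm //; case/setIP: Dr.
  rewrite fB // add0r (_ : \sum_(X in _ | _) _ = f m * chat).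
    by move/eqP; rewrite mulf_eq0 (negPf chat_nz) orbF => /eqP.
  rewrite /chat mulr_sumr; apply: eq_big => [X|X /andP[XX nXD]].
    by rewrite inE in_set1 andbC.
  by have /dcosetP[a [b [Ua Ub e]]] := lcoset_cell XX nXD; rewrite {1}e fM.
move=> x; have [Kx|/f0//] := boolP (x \in K).
move: x Kx; apply: cellsP => [u h|u h u'] *; first exact: fB.
by rewrite fM // fm0 mul0r.
Qed.

Local Notation V := 'rV[F]_#|gT|.
Let ev (v : V) x : F := v 0 (enum_rank x).
Let rv (f : gT -> F) : V := \row_i f (enum_val i).
Let evrv f x : ev (rv f) x = f x. Proof. by rewrite /ev mxE enum_rankK. Qed.
Let ev_inj v w : (forall x, ev v x = ev w x) -> v = w.
Proof. by move=> e; apply/rowP=> i; have := e (enum_val i); rewrite /ev enum_valK. Qed.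

(** Functions are coded as row vectors so that this space is a finite group, on which the fixed
    points of [U] can be counted. *)
Let W0 : {set V} := [set v | [&&
  [forall x, (x \notin K) ==> (ev v x == 0)],
  [forall x in K, forall u in U, ev v (x * u)%g == ev v x],
  [forall x in K, forall h in L, ev v (x * h)%g == ev v x * th h],
  [forall x in K, hecke (ev v) x == 0] & ev v 1%g == 0]].

Let W0P v : reflect (hecke_kernel (ev v) /\ ev v 1%g = 0) (v \in W0).
Proof.
rewrite inE; apply: (iffP and5P) => [[a b c d /eqP e]|[[a b c d] e]].
  split=> //; split=> [x nKx|x u Kx Uu|x h Kx Lh|x Kx]; apply/eqP.
  - exact: (implyP (forallP a x)).
  - exact: (forall_inP (forall_inP b x Kx)).
  - exact: (forall_inP (forall_inP c x Kx)).
  - exact: (forall_inP d).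
split; last exact/eqP.
- by apply/forallP=> x; apply/implyP=> /a->.
- by apply/forall_inP=> x Kx; apply/forall_inP=> u Uu; apply/eqP/b.
- by apply/forall_inP=> x Kx; apply/forall_inP=> u Uu; apply/eqP/c.
- by apply/forall_inP=> x Kx; apply/eqP/d.
Qed.

Let W0_group : group_set W0.
Proof.
apply/group_setP; split.
  apply/W0P; have e x : ev 1%g x = 0 by rewrite /ev mxE.
  split=> //; split=> [x _|x u _ _|x h _ _|x _]; rewrite ?e ?mul0r //.
  by rewrite /hecke big1 // => X _; rewrite e.
move=> v w /W0P[[a b c d] e] /W0P[[a' b' c' d'] e']; apply/W0P.
have ed x : ev (v * w)%g x = ev v x + ev w x by rewrite /ev mxE.
rewrite ed e e' addr0; split=> //; split=> [x nKx|x u Kx Uu|x h Kx Lh|x Kx]; rewrite ?ed.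
- by rewrite a ?a' ?addr0.
- by rewrite b ?b'.
- by rewrite c ?c' // mulrDl.
- rewrite /hecke; under eq_bigr do rewrite ed.
  by rewrite big_split /= -/(hecke _ _) -/(hecke _ _) d ?d' ?addr0.
Qed.

Let W0_pgroup : p.-group (Group W0_group).
Proof.
apply/pgroupP=> q pr_q /(Cauchy pr_q)[v _ ov].
suff vp : (v ^+ p = 1)%g.
  by move/eqP: vp; rewrite -order_dvdn ov dvdn_prime2.
by rewrite FinRing.zmodXgE -scaler_nat (pcharf0 chF) scale0r.
Qed.

Let to (v : V) u : V := rv (fun x => ev v (u * x)%g).
Let to1 v : to v 1%g = v.
Proof. by apply: ev_inj => x; rewrite evrv mul1g. Qed.
Let toM v u u' : to v (u * u')%g = to (to v u) u'.
Proof. by apply: ev_inj => x; rewrite !evrv mulgA. Qed.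

Let hecke_kernel_l f g : g \in K -> hecke_kernel f -> hecke_kernel (fun x => f (g * x)%g).
Proof.
move=> Kg [a b c d]; split=> [x nKx|x u Kx Uu|x h Kx Lh|x Kx].
- by apply: a; rewrite groupMl.
- by rewrite /= mulgA (b _ _ (groupM Kg Kx) Uu).
- by rewrite /= mulgA (c _ _ (groupM Kg Kx) Lh).
- by rewrite -[RHS](d (g * x)%g) ?groupM //; apply: eq_bigr => X _; rewrite !mulgA.
Qed.

Let eq_hecke_kernel f f' : f =1 f' -> hecke_kernel f -> hecke_kernel f'.
Proof.
move=> e [a b c d]; split=> [x nKx|x u Kx Uu|x h Kx Lh|x Kx]; rewrite -?e; auto.
by rewrite -[RHS](d x) //; apply: eq_bigr => X _; rewrite e.
Qed.

(* The p-group U fixes no nonzero vector of the F_p-space W0. *)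
Let W0_trivial : W0 = 1%g.
Proof.
pose act := TotalAction to1 toM.
have actU : [acts U, on W0 | act].
  have st v u : u \in U -> v \in W0 -> to v u \in W0.
    move=> Uu /W0P[Wv v1]; apply/W0P; rewrite evrv mulg1; split.
      by apply: eq_hecke_kernel (hecke_kernel_l (UK Uu) Wv) => x; rewrite evrv.
    (* Vanishing at 1 survives left translation because right [U]-invariance gives [v] the same
       value at [u] and at 1. *)
    by case: Wv => _ /(_ 1%g u (group1 K) Uu) + _ _; rewrite mul1g v1.
  apply/actsP=> u Uu v; apply/idP/idP=> [|/(st _ _ Uu)//].
  by move/(st _ _ (groupVr Uu)); rewrite -toM mulgV to1.
have fix1 : 'Fix_(W0 | act)(U) = [set 1%g].
  apply/setP=> v; rewrite in_setI in_set1; apply/andP/eqP=> [[Wv /afixP fv]|->]; last first.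
    split; first exact: (group1 (Group W0_group)).
    apply/afixP=> u Uu; apply: ev_inj => x; rewrite evrv /ev !mxE //.
  have [Wk v1] := W0P _ Wv; apply: ev_inj => x; rewrite [RHS]mxE.
  apply: (hecke_kernel_fixed Wk v1) => u y Uu Ky.
  by have e : to v u = v := fv u Uu; rewrite -[in RHS]e evrv.
(* The order of [W0] is congruent to its single fixed point modulo [p], which is impossible for a
   nontrivial [p]-group. *)
have := pgroup_fix_mod pU actU; rewrite fix1 cards1.
have [/(congr1 val) //|nt] := eqVneq (Group W0_group) 1%G.
have [_ pd _] := pgroup_pdiv W0_pgroup nt.
have c0 : (0 < #|W0|)%N := cardG_gt0 (Group W0_group).
move/eqP; rewrite eqn_mod_dvd // (dvdn_subr c0 pd) dvdn1 => /eqP p1.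
by have := pr_p; rewrite p1.
Qed.

Let hecke_kernel_eq0 f : hecke_kernel f -> f 1%g = 0 -> forall x, f x = 0.
Proof.
move=> Wf f1 x; have : rv f \in W0.
  apply/W0P; rewrite evrv; split=> //; apply: eq_hecke_kernel Wf => y; rewrite evrv //.
by rewrite W0_trivial => /set1P e; rewrite -(evrv f) e /ev mxE.
Qed.

Let ext_kernel : hecke_kernel ext.
Proof.
split=> [x nKx|x u Kx Uu|x h Kx Lh|x Kx]; [|exact: ext_rU|exact: ext_rL|exact: hecke_ext].
rewrite /ext (negPf nKx) ifN //; apply: contra nKx => /mulsgP[u h Uu Lh ->]; memK.
Qed.

Let ext1 : ext 1%g = 1. Proof. by rewrite -[1%g]mulg1 extB ?group1. Qed.

(* The kernel is stable under left translation and, by the above, its members are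
   determined by their value at 1. *)
Let ext_mul g x : g \in K -> x \in K -> ext (g * x)%g = ext g * ext x.
Proof.
move=> Kg Kx; apply/eqP; rewrite -subr_eq0; apply/eqP.
pose f y := ext (g * y)%g - ext g * ext y.
apply: (@hecke_kernel_eq0 f); last by rewrite /f mulg1 ext1 mulr1 subrr.
have [a b c d] := ext_kernel; have [a' b' c' d'] := hecke_kernel_l Kg ext_kernel.
rewrite /f; split=> [y nKy|y u Ky Uu|y h Ky Lh|y Ky].
- by have /= -> := a' y nKy; rewrite (a y nKy) mulr0 subrr.
- by have /= -> := b' y u Ky Uu; rewrite (b y u Ky Uu).
- by have /= -> := c' y h Ky Lh; rewrite (c y h Ky Lh) mulrBl mulrA.
- rewrite /hecke sumrB -mulr_sumr; have := d' y Ky; rewrite /hecke /= => ->.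
  by have := d y Ky; rewrite /hecke => ->; rewrite mulr0 subrr.
Qed.

(** [ext] is multiplicative on [K] and equal to 1 on [U], hence also on [U :^ m], and these two
    generate [K]; on [L] it is [th]. *)
Lemma chat_nz_trivial h : h \in L -> th h = 1.
Proof.
move=> Lh; pose Q := [set g in K | ext g == 1].
have gQ : group_set Q.
  apply/group_setP; split; first by rewrite inE group1 ext1 /=.
  move=> x y; rewrite !inE => /andP[Kx /eqP ex] /andP[Ky /eqP ey].
  by rewrite groupM //= ext_mul // ex ey mulr1.
have extU u : u \in U -> ext u = 1 by move=> Uu; rewrite -[u]mulg1 extB.
have : K \subset Group gQ.
  rewrite genK gen_subG subUset; apply/andP; split; apply/subsetP=> u Uu; rewrite inE.
    by rewrite UK // extU /=.
  rewrite mem_conjg in Uu; rewrite -[u](conjgKV m) conjgE; set v := (u ^ m^-1)%g in Uu *.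
  have Kv := UK Uu; apply/andP; split; first by memK.
  have Km' := groupVr mK; have Kvm := groupM Kv mK.
  by rewrite ext_mul // ext_mul // (extU v Uu) mul1r -ext_mul // mulVg ext1.
move/subsetP/(_ h (LK Lh)); rewrite inE => /andP[_].
by have := extB (group1 U) Lh; rewrite mul1g => -> /eqP.
Qed.

End Character.

Lemma rank_one_surj h : h \in L -> exists2 u, u \in U & m * u * m \in E (m * h).
Proof.
move=> Lh; have k0 : 0 < totient #|L| by rewrite totient_gt0 cardG_gt0.
(* With [p ^ totient #|L|] elements, [#|F|] is 1 modulo [#|L|] by Euler, as Fourier inversion over
   [F] requires. *)
have [F chF cF] := pPrimePowerField pr_p k0.
have expLF g : g \in L -> g ^+ #|F| = g.
  move=> Lg; have co : coprime p #|L| by rewrite prime_coprime // -p'natE.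
  apply/eqP; rewrite cF -{2}[g]expg1 eq_expg_mod_order.
  by rewrite -(modn_dvdm _ (order_dvdG Lg)) Euler_exp_totient // modn_dvdm // order_dvdG.
pose XX := lcosets D U :\ (D : {set gT}).
pose lp X := lpart (m * repr X * m).
pose c (g : gT) : F := #|[set X in XX | lp X == g]|%:R%R.
have sumc (th : gT -> F) : (\sum_(g in L) c g * th g)%R = chat th.
  rewrite /chat (partition_big lp (mem L)) /=; last by move=> X _; apply: lpart_in.
  apply: eq_bigr => g Lg; rewrite (eq_bigr (fun=> th g)); last by move=> X /andP[_ /eqP<-].
  by rewrite sumr_const -mulr_natl /c cardsE.
have cst : forall g, g \in L -> c g = c 1.
  apply: fun_eq_cst_of_characters => // th th1 thM [g Lg nth]; rewrite sumc; apply/eqP.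
  by apply: contraNT nth => nz; rewrite (chat_nz_trivial chF th1 thM nz).
(* The counts add up to [#|U : D| - 1], that is to -1 in [F], so their common value cannot be 0. *)
have sum1 : chat (fun=> 1%R) = (-1 : F)%R.
  rewrite /chat sumr_const; apply/eqP; rewrite -subr_eq0 opprK -mulrSr -(dvdn_pcharf chF).
  by have := p_dvd_lcosets; rewrite (cardsD1 D) DinDU add1n.
have c1 : c 1 != 0%R.
  apply/eqP => c0; move: (sumc (fun=> 1%R)); rewrite sum1 big1 => [/eqP|g Lg].
    by rewrite eq_sym oppr_eq0 oner_eq0.
  by rewrite cst // c0 mul0r.
have : [set X in XX | lp X == h] != set0.
  by apply: contraNneq c1 => e; rewrite -(cst h Lh) /c e cards0.
case/set0Pn=> X; rewrite !inE => /andP[/andP[nXD XD] /eqP <-].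
by exists (repr X); [apply: repr_U | apply: lcoset_cell].
Qed.

End RankOne.

(** * Reflections and length *)

Section SplitBNPair.
Variables (gT : finGroupType) (p : nat) (G B N H U : {group gT}).
Variable S : {set coset_of H}.
Hypothesis pr_p : prime p.
Hypothesis BNp : split_BN_pair p G B N H U S.

Implicit Types g n x r t h b u m z : gT.

Notation C := (dcoset B).
Notation E := (dcoset U).
(** All representatives of the generators are kept: the cells [E n] depend on [n] itself and not
    only on its coset modulo [H]. *)
Definition refl := [set r in N | coset H r \in S].
Notation R := refl.

Lemma reflN r : r \in R -> r \in N.
Proof. by rewrite inE; case/andP. Qed.

Let genG : G :=: <<B :|: N>>. Proof. by case: BNp => [[]]. Qed.
Let defH : H :=: B :&: N. Proof. by case: BNp => [[]]. Qed.
Let nsHN : H <| N. Proof. by case: BNp => [[]]. Qed.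
Let genS : <<S>> = N / H. Proof. by case: BNp => [[]]. Qed.

Let nUB : U <| B. Proof. by case: BNp => _ _ []. Qed.
Let defB : U * H = B. Proof. by case: BNp => _ _ []. Qed.
Let pU : p.-group U. Proof. by case: BNp => _ _ []. Qed.
Let cHH : abelian H. Proof. by case: BNp => _ _ []. Qed.
Let pH : p^'.-group H. Proof. by case: BNp. Qed.

Let HB h : h \in H -> h \in B. Proof. by rewrite defH inE; case/andP. Qed.
Let HN h : h \in H -> h \in N. Proof. by rewrite defH inE; case/andP. Qed.
Let UB u : u \in U -> u \in B. Proof. exact: subsetP (normal_sub nUB) u. Qed.
Let BG b : b \in B -> b \in G.
Proof. by move=> Bb; rewrite genG mem_gen // inE Bb. Qed.
Let NG b : b \in N -> b \in G.
Proof. by move=> Bb; rewrite genG mem_gen // inE Bb orbT. Qed.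
Let nHN n : n \in N -> n \in 'N(H).
Proof. exact: subsetP (normal_norm nsHN) n. Qed.
Let BNH n : n \in B -> n \in N -> n \in H. Proof. by rewrite defH inE => -> ->. Qed.
Let HJ n h : n \in N -> (h ^ n \in H) = (h \in H).
Proof. by move=> /nHN Nn; rewrite memJ_norm. Qed.
Let UJ b u : b \in B -> (u ^ b \in U) = (u \in U).
Proof. by move=> Bb; rewrite memJ_norm // (subsetP (normal_norm nUB)). Qed.

Local Hint Extern 0 (is_true (_ \in _)) =>
  solve [apply: HN; assumption | apply: HB; assumption
       | apply: UB; assumption | apply: reflN; assumption] : core.

Local Ltac mem :=
  repeat match goal with |- is_true (_ \in _) =>
    first [assumption | done | apply: groupM | apply: groupVr] end.

Lemma reflV r : r \in R -> r^-1 \in R.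
Proof.
rewrite !inE groupV => /andP[Nr Sr]; rewrite Nr morphV ?nHN //=.
have [_ [h _ _] _ _ _] := BNp.
suff -> : (coset H r)^-1 = coset H r by [].
by apply/eqP; rewrite eq_invg_mul -expg2 -(h _ Sr) expg_order.
Qed.

Lemma refl_sqr r : r \in R -> r * r \in H.
Proof.
rewrite inE => /andP[Nr Sr]; have [_ [h _ _] _ _ _] := BNp; have o2 := h _ Sr.
apply: coset_idr; first by rewrite groupM ?nHN.
by rewrite morphM ?nHN // -expg2 -o2 expg_order.
Qed.

Lemma reflMr r h : r \in R -> h \in H -> r * h \in R.
Proof.
rewrite !inE => /andP[Nr Sr] Hh.
by rewrite groupM  // coset_kerr.
Qed.

Lemma refl_cells r n b : r \in R -> n \in N -> b \in B ->
  r * b * n \in C n \/ r * b * n \in C (r * n).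
Proof.
rewrite inE => /andP[Nr Sr] Nn Bb; have [_ [_ h _] _ _ _] := BNp.
have /subsetP/(_ (r * b * n)) := h _ _ Nr Sr Nn.
by rewrite inE mem_rcoset mulgK mem_lcoset mulKg => /(_ Bb)/orP.
Qed.

Lemma refl_unstable r : r \in R -> exists2 b, b \in B & r * b * r \notin B.
Proof.
rewrite inE => /andP[Nr Sr]; have [_ [_ _ h] _ _ _] := BNp.
have := h _ Nr Sr; rewrite eqEcard card_rcoset card_lcoset leqnn andbT.
case/subsetPn=> x; rewrite mem_rcoset mem_lcoset => Bx nBx.
by exists (r^-1 * (x * r^-1)) => //; rewrite mulKVg mulgKV.
Qed.

Lemma reflNH r : r \in R -> r \notin H.
Proof.
move=> Rr; apply/negP=> Hr; have [b Bb /negP[]] := refl_unstable Rr.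
by rewrite !groupM .
Qed.

(** The first disjunct makes the length total, with value 0 outside [N]. *)
Fact len_ex n : exists k, (n \notin N) || (coset H n \in S ^+ k).
Proof.
have [Nn|nNn] := boolP (n \in N); last by exists 0.
have: coset H n \in <<S>> by rewrite genS mem_quotient.
case/gen_prodgP=> k [c Sc ->]; exists k; rewrite orFb.
elim: k c Sc => [|k IH] c Sc; first by rewrite big_ord0 expg0 inE.
rewrite big_ord_recl expgS mem_mulg ?Sc //; exact: IH.
Qed.

Definition len n := ex_minn (len_ex n).

Let Sinv k w : w \in S ^+ k -> w^-1 \in S ^+ k.
Proof.
elim: k w => [|k IH] w; first by rewrite expg0 !inE invg_eq1.
rewrite expgS => /mulsgP[s v Ss Sv ->]; rewrite invMg -expgS expgSr mem_mulg ?IH //.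
have [_ [h _ _] _ _ _] := BNp.
suff -> : s^-1 = s by [].
by apply/eqP; rewrite eq_invg_mul -expg2 -(h s Ss) expg_order.
Qed.

Lemma len_expS n k : n \in N -> coset H n \in S ^+ k -> len n <= k.
Proof.
by rewrite /len => Nn Sn; case: ex_minnP => m _; apply; rewrite Sn orbT.
Qed.

Lemma expS_len n : n \in N -> coset H n \in S ^+ len n.
Proof. by rewrite /len => Nn; case: ex_minnP => m; rewrite Nn. Qed.

Lemma lenV n : n \in N -> len n^-1 = len n.
Proof.
suff h x : x \in N -> len x^-1 <= len x.
  move=> Nn; apply/eqP; rewrite eqn_leq h //.
  by rewrite -{1}[n]invgK h ?groupV.
move=> Nx; apply: len_expS; rewrite ?groupV // morphV ?nHN //.
exact/Sinv/expS_len.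
Qed.

Lemma lenMl h n : h \in H -> n \in N -> len (h * n) = len n.
Proof.
suff le x y : x \in H -> y \in N -> len (x * y) <= len y.
  move=> Hh Nn; apply/eqP; rewrite eqn_leq le //.
  by rewrite -{1}[n](mulKg h) le ?groupV ?groupM .
by move=> Hx Ny; apply: len_expS; rewrite ?groupM  // coset_kerl ?expS_len.
Qed.

Lemma lenMr h n : h \in H -> n \in N -> len (n * h) = len n.
Proof.
by move=> Hh Nn; rewrite -lenV ?groupM  // invMg lenMl ?groupV // lenV.
Qed.

Lemma len_eq0 n : n \in N -> (len n == 0) = (n \in H).
Proof.
move=> Nn; apply/eqP/idP=> [l0|Hn]; last first.
  by apply/eqP; rewrite -leqn0 len_expS // coset_id // expg0 inE.
have := expS_len Nn; rewrite l0 expg0 inE => /eqP; apply: coset_idr; exact: nHN.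
Qed.

Lemma len_reflM r n : r \in R -> n \in N -> len (r * n) <= (len n).+1.
Proof.
rewrite inE => /andP[Nr Sr] Nn; apply: len_expS; first exact: groupM.
by rewrite morphM ?nHN // expgS mem_mulg // expS_len.
Qed.

Lemma len_Mrefl r n : r \in R -> n \in N -> len (n * r) <= (len n).+1.
Proof.
move=> Rr Nn; rewrite -lenV ?groupM  // invMg -[len n]lenV //.
by rewrite len_reflM ?reflV ?groupV.
Qed.

Lemma len_descent n : n \in N -> 0 < len n ->
  exists2 r, r \in R & len n = (len (r * n)).+1.
Proof.
move=> Nn; case e: (len n) => [//|k] _.
have := expS_len Nn; rewrite e expgS => /mulsgP[s v Ss Sv eqn].
have /morphimP[r Nr Nr' es]: s \in N / H.
  by rewrite -genS mem_gen.
have Rr : r \in R by rewrite inE Nr' /= -es.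
exists r^-1; first exact: reflV.
have le : len (r^-1 * n) <= k.
  apply: len_expS; first by rewrite groupM ?groupV.
  by rewrite morphM ?groupV ?nHN // morphV ?nHN //= eqn -es mulKg.
have := len_reflM Rr (groupM (groupVr Nr') Nn); rewrite mulKVg e ltnS => ge.
by apply/eqP; rewrite eqSS eqn_leq ge.
Qed.

Lemma len_descent_r n : n \in N -> 0 < len n ->
  exists2 r, r \in R & len n = (len (n * r)).+1.
Proof.
move=> Nn; rewrite -lenV // => /(len_descent (groupVr Nn))[r Rr ->].
exists r^-1; first exact: reflV.
by rewrite -[in RHS]lenV ?groupM ?groupV  // invMg invgK.
Qed.

(** * Bruhat decomposition and the exchange condition *)

Lemma reflM_cell r n g : r \in R -> n \in N -> g \in C n ->
  r * g \in C n \/ r * g \in C (r * n).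
Proof.
move=> Rr Nn /dcosetP[b [b' [Bb Bb' ->]]].
have -> : r * (b * n * b') = r * b * n * b' by rewrite !mulgA.
by rewrite !(mem_dcosetr _ _ Bb'); apply: refl_cells.
Qed.

Lemma cellM_refl r n g : r \in R -> n \in N -> g \in C n ->
  g * r \in C n \/ g * r \in C (n * r).
Proof.
move=> Rr Nn gn; have := @reflM_cell r^-1 n^-1 g^-1; rewrite -!invMg !dcoset_inv.
by apply; rewrite ?groupV //; apply: reflV.
Qed.

Lemma cell_inH n n' : n \in N -> n' \in N -> n^-1 * n' \in H -> n' \in C n.
Proof.
move=> Nn Nn' Hn; apply/dcosetP; exists 1, (n^-1 * n').
by split; rewrite ?group1 // ?HB // mul1g mulKVg.
Qed.

Lemma HJV n h : n \in N -> h \in H -> n * h * n^-1 \in H.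
Proof.
by move=> Nn Hh; rewrite -mulgA -{1}[n]invgK -/(conjg h n^-1) HJ ?groupV.
Qed.

(** Induction on the length of the shorter element [x]. A descent [r] of [x] puts [r * x] in [C y]
    or in [C (r * y)]: the first would make [y] shorter than [x], and the second is an instance with
    a shorter left element. *)
Lemma cell_inj n n' : n \in N -> n' \in N -> n' \in C n -> n^-1 * n' \in H.
Proof.
suff hh k x y : x \in N -> y \in N -> y \in C x -> len x <= k -> len x <= len y -> x^-1 * y \in H.
  move=> Nn Nn' nn'; have [le|/ltnW le] := leqP (len n) (len n'); first exact: (hh (len n)).
  by rewrite -groupV invMg invgK; apply: (hh (len n')); rewrite // dcoset_sym.
elim: k x y => [|k IH] x y Nx Ny xy.
  rewrite leqn0 len_eq0 // => Hx _; rewrite groupMl ?groupV //; apply: BNH => //.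
  by case/dcosetP: xy => b [b' [Bb Bb' ->]]; mem.
move=> lx lxy; have [l0|/(len_descent Nx)[r Rr lr]] := posnP (len x).
  by apply: IH; rewrite ?l0.
have Nr := reflN Rr.
have [] := reflM_cell Rr Ny (_ : x \in C y); first by rewrite dcoset_sym.
  rewrite dcoset_sym => h.
  have := IH (r * x) y (groupM Nr Nx) Ny h; rewrite lr in lx lxy.
  move=> /(_ lx (ltnW lxy)) Hh.
  have := lenMr Hh (groupM Nr Nx); rewrite mulKVg => e.
  by rewrite e ltnn in lxy.
rewrite dcoset_sym => h.
have := IH (r * x) (r * y) (groupM Nr Nx) (groupM Nr Ny) h.
rewrite invMg mulgA mulgKV; apply; first by rewrite -ltnS -lr.
rewrite -ltnS -lr; apply: (leq_trans lxy).
have := len_reflM (reflV Rr) (groupM Nr Ny); rewrite mulKg //.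
Qed.

Lemma cell_len n n' : n \in N -> n' \in N -> n' \in C n -> len n' = len n.
Proof.
move=> Nn Nn' /(cell_inj Nn Nn') Hh; by rewrite -[n'](mulKVg n) lenMr.
Qed.

Lemma reflM_notcell r n : r \in R -> n \in N -> r * n \notin C n.
Proof.
move=> Rr Nn; apply/negP=> /(cell_inj Nn (groupM (reflN Rr) Nn)) Hh.
have := HJV Nn Hh; rewrite mulKVg mulgK.
exact/negP/reflNH.
Qed.

(* Multiplying by t^-1 on the right shows r b x in C(xt) or C(x). *)
Lemma cell_exchange r t x b : r \in R -> t \in R -> x \in N -> b \in B ->
  r * b * x \in C (r * x) -> r * b * (x * t) \in C (x * t) -> (x * t)^-1 * (r * x) \in H.
Proof.
move=> Rr Rt Nx Bb h1 h2; have Nr := reflN Rr; have Nt := reflN Rt.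
have e : r * b * (x * t) * t^-1 = r * b * x by rewrite !mulgA mulgK.
have [] := cellM_refl (reflV Rt) (groupM Nx Nt) h2; rewrite e ?mulgK => h.
  apply: cell_inj; [mem|mem|].
  by apply: (dcoset_trans h); rewrite dcoset_sym.
case/negP: (reflM_notcell Rr Nx).
by apply: (dcoset_trans h); rewrite dcoset_sym.
Qed.

Lemma conj_refl_len r t x : r \in R -> t \in R -> x \in N ->
  (x * t)^-1 * (r * x) \in H -> len (r * (x * t)) = len x.
Proof.
move=> Rr Rt Nx Hh; have Nr := reflN Rr; have Nt := reflN Rt.
have -> : r * (x * t) = x * (t * t * ((x * t)^-1 * (r * x)) ^ t).
  by rewrite conjgE !invMg !mulgA !mulgK mulgV mul1g.
by rewrite lenMr // groupM ?refl_sqr // HJ.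
Qed.

(** Induction on [len n], peeling a reflection off the right to get a shorter [x], for which
    [len x <= len (r * x)] still holds. If [r * b * n] stayed in [C n], [cell_exchange] would put
    [r * x] in [n H], so that [r * n] would have the length of [x]. *)
Lemma cell_len_le r n b : r \in R -> n \in N -> b \in B ->
  len n <= len (r * n) -> r * b * n \in C (r * n).
Proof.
move=> Rr; have Nr := reflN Rr; have [k] := ubnP (len n); elim: k n b => // k IH n b lk Nn Bb le.
have [l0|/(len_descent_r Nn)[t Rt lt]] := posnP (len n).
  have Hn : n \in H by rewrite -len_eq0 // l0.
  by rewrite mem_dcosetr ?HB // mem_dcosetr // dcoset_sym mem_dcosetr ?HB // dcoset_id.
have Nt := reflN Rt; set x := n * t in lt; have Nx : x \in N by rewrite groupM.
have en : n = x * t^-1 by rewrite mulgK.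
have Rt' := reflV Rt.
have h1 : r * b * x \in C (r * x).
  apply: IH => //; first by rewrite -ltnS -lt.
  rewrite -ltnS -lt; apply: (leq_trans le); rewrite en mulgA.
  by rewrite len_Mrefl // groupM.
have [h2|//] := refl_cells Rr Nn Bb.
have Hh : (x * t^-1)^-1 * (r * x) \in H by apply: (@cell_exchange _ _ _ b); rewrite // -en.
have := conj_refl_len Rr Rt' Nx Hh; rewrite -en => e.
by rewrite e lt ltnn in le.
Qed.

Lemma refl_sqr_cell r : r \in R -> exists2 b, b \in B & r * b * r \in C r.
Proof.
move=> Rr; have [b Bb nB] := refl_unstable Rr; exists b => //.
have [//|] := refl_cells Rr (reflN Rr) Bb.
case/dcosetP=> c [c' [Bc Bc' e]]; case/negP: nB; rewrite e.
exact: groupM (groupM Bc (HB (refl_sqr Rr))) Bc'.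
Qed.

(** With equal lengths [cell_len_le] applies both at [n] and at [r * n]. Taking [b] with [r * b * r]
    in [C r], it places [r * b * r * n] in two different cells. *)
Lemma len_refl_neq r n : r \in R -> n \in N -> len (r * n) != len n.
Proof.
move=> Rr Nn; apply/eqP=> e; have Nr := reflN Rr.
have [b Bb /dcosetP[c [c' [Bc Bc' e']]]] := refl_sqr_cell Rr.
have h1 : r * b * (r * n) \in C (r * n).
  rewrite mulgA e' -!mulgA mem_dcosetl // mulgA cell_len_le //.
  by rewrite e.
have h2 : r * b * (r * n) \in C (r * (r * n)).
  apply: cell_len_le => //; first by mem.
  by rewrite (mulgA r r) (lenMl (refl_sqr Rr) Nn) e.
case/negP: (reflM_notcell Rr (groupM Nr Nn)).
by apply: (dcoset_trans h1); rewrite dcoset_sym.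
Qed.

Lemma len_reflP r n : r \in R -> n \in N ->
  len (r * n) = (len n).+1 \/ len n = (len (r * n)).+1.
Proof.
move=> Rr Nn; have := len_refl_neq Rr Nn; have Nr := reflN Rr.
rewrite neq_ltn => /orP[] lt; [right|left]; apply/eqP; rewrite eqn_leq lt ?andbT /=.
  by have := len_reflM (reflV Rr) (groupM Nr Nn); rewrite mulKg.
exact: len_reflM.
Qed.

Lemma len_reflV r n : r \in R -> n \in N -> len (r^-1 * n) = len (r * n).
Proof.
move=> Rr Nn; have Nr := reflN Rr.
rewrite -[LHS](@lenMl (r * r)) ?refl_sqr //; last by mem.
by rewrite mulgA mulgK.
Qed.

(** Writing [n] as [r * (r^-1 * n)] brings in [r * b * r], which lies in [C r] for a suitable [b];
    the remaining [r] lengthens [r^-1 * n]. *)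
Lemma cell_len_gt r n : r \in R -> n \in N -> len (r * n) < len n ->
  exists2 b, b \in B & r * b * n \in C n.
Proof.
move=> Rr Nn lt; have Nr := reflN Rr.
have [b Bb /dcosetP[c [c' [Bc Bc' e]]]] := refl_sqr_cell Rr.
exists b => //; have -> : r * b * n = c * (r * c' * (r^-1 * n)).
  by rewrite !mulgA -e mulgK.
rewrite mem_dcosetl //; have := @cell_len_le r (r^-1 * n) c' Rr; rewrite mulKVg; apply=> //.
  by mem.
by rewrite len_reflV // ltnW.
Qed.

(** The exchange condition. Lengthening [x] puts [r * b * x] in [C (r * x)] for every [b], while
    shortening [x * t] keeps some [r * b * (x * t)] in [C (x * t)]. *)
Lemma fold_exchange r t x : r \in R -> t \in R -> x \in N ->
  len x < len (r * x) -> len (r * (x * t)) < len (x * t) -> (x * t)^-1 * (r * x) \in H.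
Proof.
move=> Rr Rt Nx l1 l2; have Nt := reflN Rt.
have [b Bb h] := cell_len_gt Rr (groupM Nx Nt) l2.
by apply: (@cell_exchange _ _ _ b); rewrite // cell_len_le // ltnW.
Qed.

Lemma NM_cell n n' g : n \in N -> n' \in N -> g \in C n' ->
  exists2 n'', n'' \in N & n * g \in C n''.
Proof.
have [k] := ubnP (len n); elim: k n g => // k IH n g lk Nn Nn' gn'.
have [l0|/(len_descent Nn)[r Rr lr]] := posnP (len n).
  have Hn : n \in H by rewrite -len_eq0 // l0.
  by exists n'; rewrite // mem_dcosetl // HB.
have Nr := reflN Rr.
have [x Nx gx] : exists2 x, x \in N & r * n * g \in C x.
  by apply: IH => //; [rewrite -ltnS -lr | mem].
have [] := reflM_cell (reflV Rr) Nx gx; rewrite -mulgA mulKg => h; first by exists x.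
by exists (r^-1 * x) => //; mem.
Qed.

Lemma bruhat g : g \in G -> exists2 n, n \in N & g \in C n.
Proof.
rewrite genG => /gen_prodgP[k [c cBN ->]].
elim: k c cBN => [|k IH] c cBN.
  by rewrite big_ord0; exists 1; rewrite ?group1 // dcoset_id.
rewrite big_ord_recl; have [n Nn hn] := IH (fun i => c (lift ord0 i)) (fun i => cBN _).
have := cBN ord0; rewrite inE => /orP[Bc|Nc]; last exact: NM_cell hn.
by exists n; rewrite // mem_dcosetl.
Qed.

(** * The refined cells [U n U] *)

Let hallU : p.-Hall(B) U.
Proof.
rewrite /pHall normal_sub // pU -divgS ?normal_sub //= -defB TI_cardMg ?mulKn //.
by case: BNp => _ _ [].
Qed.

Let pelt u g : u \in U -> u ^ g \in B -> u ^ g \in U.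
Proof.
move=> Uu Bu; rewrite (mem_normal_Hall hallU) //.
by rewrite p_eltJ (mem_p_elt pU).
Qed.

Let UH1 h : h \in U -> h \in H -> h = 1.
Proof.
move=> Uh Hh; have [_ _ [_ _ UH _ _] _ _] := BNp.
by have : h \in U :&: H; [rewrite inE Uh | rewrite UH => /set1P].
Qed.

Lemma dcosetHl h n g : h \in H -> (h * g \in E (h * n)) = (g \in E n).
Proof.
move=> Hh; suff hh x y k : k \in H -> x \in E y -> k * x \in E (k * y).
  by apply/idP/idP=> [/(hh _ _ _ (groupVr Hh))|/hh->//]; rewrite !mulKg.
move=> Hk /dcosetP[a [b [Ua Ub ->]]]; apply/dcosetP; exists (a ^ k^-1), b.
by rewrite UJ ?groupV ?HB //; split=> //; rewrite conjgE invgK !mulgA mulgKV.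
Qed.

Lemma dcosetHr h n g : h \in H -> (g * h \in E (n * h)) = (g \in E n).
Proof.
by move=> Hh; rewrite -[LHS]dcoset_inv !invMg dcosetHl ?groupV // dcoset_inv.
Qed.

Lemma dcoset_UB n g : g \in E n -> g \in C n.
Proof.
by case/dcosetP=> a [b [Ua Ub ->]]; apply/dcosetP; exists a, b; split; rewrite // UB.
Qed.

Let BUH b : b \in B -> exists u h, [/\ u \in U, h \in H & b = u * h].
Proof. by rewrite -defB => /mulsgP[u h Uu Hh ->]; exists u, h. Qed.

Lemma cell_split n g : n \in N -> g \in C n -> exists2 h, h \in H & g \in E (n * h).
Proof.
move=> Nn /dcosetP[b [b' [/BUH[u [h [Uu Hh ->]]] + ->]]].
rewrite -groupV => /BUH[u' [h' [Uu' Hh' /(canRL invgK) ->]]].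
exists (h ^ n * h'^-1); first by rewrite groupM ?groupV ?HJ.
apply/dcosetP; exists u, u'^-1; rewrite groupV; split=> //.
by rewrite conjgE invMg !mulgA mulgK.
Qed.

Lemma bruhatU g : g \in G -> exists2 n, n \in N & g \in E n.
Proof.
case/bruhat=> n Nn /(cell_split Nn)[h Hh gh]; exists (n * h) => //.
by mem.
Qed.

(** By [cell_inj] the two differ by an element of [H]. Up to a factor in [U] that element is
    [u ^ n], a [p]-element of [B], so it lies in both [U] and [H]. *)
Lemma dcosetU_inj n n' : n \in N -> n' \in N -> n' \in E n -> n = n'.
Proof.
move=> Nn Nn' nn'; have Hh := cell_inj Nn Nn' (dcoset_UB nn').
case/dcosetP: nn' => u [u' [Uu Uu' e]].
have e' : u ^ n = n^-1 * n' * u'^-1 by rewrite e conjgE !mulgA mulgK.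
have : u ^ n \in U by apply: pelt; rewrite // e'; mem.
rewrite e' groupMr ?groupV // => /UH1/(_ Hh)/eqP.
by rewrite -eq_invg_mul invgK => /eqP.
Qed.

(* That p-elements of B lie in U replaces the decomposition of U into root subgroups. *)
Lemma dcosetUM r n g g' : r \in R -> n \in N -> len n < len (r * n) ->
  g \in E r -> g' \in E n -> g * g' \in E (r * n).
Proof.
move=> Rr Nn lt; have Nr := reflN Rr; have Nrn := groupM Nr Nn.
suff hh u : u \in U -> r * u * n \in E (r * n).
  case/dcosetP=> a [b [Ua Ub ->]] /dcosetP[a' [b' [Ua' Ub' ->]]].
  have -> : a * r * b * (a' * n * b') = a * (r * (b * a') * n) * b' by rewrite !mulgA.
  by rewrite mem_dcosetr // mem_dcosetl // hh // groupM.
move=> Uu; have [h Hh /dcosetP[a [b [Ua Ub e]]]] :=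
  cell_split Nrn (cell_len_le Rr Nn (UB Uu) (ltnW lt)).
have ec : (a^-1) ^ r * u * n = n * h * b.
  rewrite conjgE -!mulgA (mulgA r u) e !mulgA mulgKV mulVg mul1g //.
(* This conjugate lies in [B] or in [C r]; the second would put [n * h * b], an element of [C n], in
   [C (r * n)] as well. *)
have Uc : (a^-1) ^ r \in U.
  apply: pelt; first by rewrite groupV.
  have [] := refl_cells (reflV Rr) Nr (UB (groupVr Ua)); last first.
    rewrite -mulgA mulVg -conjgE => /dcosetP[c [c' [Bc Bc' ->]]].
    by rewrite mulg1 groupM.
  rewrite -mulgA -conjgE => /dcosetP[c [c' [Bc Bc' ec']]].
  case/negP: (reflM_notcell Rr Nn); rewrite dcoset_sym.
  rewrite -(mem_dcosetr _ _ (groupM (HB Hh) (UB Ub))) mulgA -ec ec'.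
  rewrite -!mulgA mem_dcosetl // (mulgA c') (mulgA r).
  by apply: cell_len_le; rewrite ?(ltnW lt) //; mem.
(* A conjugate of an element of [U] that falls in [B] falls in [U], and this forces [h = 1]. *)
have eh : ((a^-1) ^ r * u) ^ n = h * b by rewrite conjgE ec !mulgA mulVg mul1g.
have : h * b \in U.
  by rewrite -eh; apply: pelt; rewrite ?eh; mem.
rewrite groupMr // => /UH1/(_ Hh) h1.
by apply/dcosetP; exists a, b; split=> //; rewrite e h1 mulg1.
Qed.

Lemma dcosetUMr r n g g' : r \in R -> n \in N -> len n < len (n * r) ->
  g \in E n -> g' \in E r -> g * g' \in E (n * r).
Proof.
move=> Rr Nn lt gn gr; have Nr := reflN Rr; rewrite -dcoset_inv !invMg.
apply: dcosetUM; rewrite ?dcoset_inv ?reflV ?groupV //.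
by rewrite -invMg !lenV ?groupM.
Qed.

(** * Rank one subgroups of [G], their tori and monomial elements *)

Definition parab r : {group gT} := <<U :|: U :^ r>>%G.
Definition torus r : {group gT} := (H :&: parab r)%G.
Definition monom r : {set gT} := (N :&: parab r) :\: H.
Notation K := parab.
Notation T := torus.
Notation M := monom.

Let UK r u : u \in U -> u \in K r.
Proof. by move=> Uu; rewrite mem_gen // inE Uu. Qed.
Let UJK r u : u \in U -> u ^ r \in K r.
Proof. by move=> Uu; rewrite mem_gen // inE memJ_conjg Uu orbT. Qed.
Let TH r h : h \in T r -> h \in H. Proof. by case/setIP. Qed.
Let TK r h : h \in T r -> h \in K r. Proof. by case/setIP. Qed.
Let MN r m : m \in M r -> m \in N. Proof. by case/setDP=> /setIP[]. Qed.
Let MK r m : m \in M r -> m \in K r. Proof. by case/setDP=> /setIP[]. Qed.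

(** The union of the two cells is stable under left multiplication by [B], [r] and [r^-1], hence by
    the generators of [K r]. *)
Lemma parab_cells r g : r \in R -> g \in K r -> g \in B \/ g \in C r.
Proof.
move=> Rr; have Nr := reflN Rr.
pose X : {set gT} := B :|: C r.
have XB b x : b \in B -> x \in X -> b * x \in X.
  by move=> Bb; rewrite !inE groupMl // mem_dcosetl.
have Xr x : x \in X -> r * x \in X.
  rewrite !inE => /orP[Bx|/(reflM_cell Rr Nr)[->|]]; rewrite ?orbT //.
    by rewrite mem_dcosetr // dcoset_id orbT.
  case/dcosetP=> b [b' [Bb Bb' ->]].
  by rewrite (groupM (groupM Bb (HB (refl_sqr Rr))) Bb').
have XrV x : x \in X -> r^-1 * x \in X.
  move=> Xx; have -> : r^-1 * x = (r * r)^-1 * (r * x) by rewrite invMg !mulgA mulgKV.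
  by apply: XB; [rewrite groupV HB ?refl_sqr | apply: Xr].
suff : g \in K r -> g \in X by move=> h /h; rewrite inE => /orP.
case/gen_prodgP=> k [c cU ->]; elim: k c cU => [|k IH] c cU.
  by rewrite big_ord0 inE group1.
rewrite big_ord_recl; have := IH (fun i => c (lift ord0 i)) (fun i => cU _).
move: (\prod_(i < k) _) => y Xy; have := cU ord0.
rewrite inE => /orP[Uc|]; first by apply: XB.
rewrite mem_conjg -[X in X * y](conjgKV r); move: (_ ^ r^-1) => u Uu.
by rewrite conjgE -!mulgA; apply: XrV; apply: XB (UB Uu) (Xr _ Xy).
Qed.

Lemma monomH r m : r \in R -> m \in M r -> r^-1 * m \in H.
Proof.
move=> Rr Mm; have Nm := MN Mm; have [Bm|h] := parab_cells Rr (MK Mm).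
  by case/setDP: Mm => _ /negP[]; apply: BNH.
by apply: cell_inj => //; apply: reflN.
Qed.

Lemma monom_refl r m : r \in R -> m \in M r -> m \in R.
Proof. by move=> Rr Mm; rewrite -[m](mulKVg r); apply: reflMr => //; apply: monomH. Qed.

Lemma parab_eq r r' : r \in R -> r^-1 * r' \in H -> K r' = K r.
Proof.
move=> Rr Hh; apply: val_inj => /=; congr <<_ :|: _>>.
have -> : r' = (r * (r^-1 * r') * r^-1) * r by rewrite mulgKV mulKVg.
rewrite conjsgM; congr (_ :^ r); apply: normP.
by apply: (subsetP (normal_norm nUB)); apply/HB/HJV => //; apply: reflN.
Qed.

Lemma parab_monom r m : r \in R -> m \in M r -> K m = K r.
Proof. by move=> Rr Mm; apply: parab_eq => //; apply: monomH. Qed.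

Lemma monom_torus r m m' : r \in R -> m \in M r -> m' \in M r -> m^-1 * m' \in T r.
Proof.
move=> Rr Mm Mm'; rewrite inE (groupM (groupVr (MK Mm)) (MK Mm')) andbT.
have -> : m^-1 * m' = (r^-1 * m)^-1 * (r^-1 * m') by rewrite invMg invgK mulgA mulgK.
by apply: groupM; rewrite ?groupV monomH.
Qed.

Lemma monomM_torus r m m' : r \in R -> m \in M r -> m' \in M r -> m * m' \in T r.
Proof.
move=> Rr Mm Mm'; rewrite inE (groupM (MK Mm) (MK Mm')) andbT.
have -> : m * m' = (m * m) * (m^-1 * m') by rewrite !mulgA mulgK.
apply: groupM; first exact/refl_sqr/(monom_refl Rr).
exact/TH/(monom_torus Rr Mm).
Qed.

Lemma monomMr r m h : m \in M r -> h \in T r -> m * h \in M r.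
Proof.
move=> Mm Th; have /setDP[/setIP[Nm Km] nHm] := Mm; have Hh := TH Th.
rewrite !inE groupMr // nHm /=; apply/andP; split; first by mem.
exact: groupM Km (TK Th).
Qed.

Lemma torusJ r m h : m \in M r -> (h ^ m \in T r) = (h \in T r).
Proof. by move=> Mm; rewrite !inE HJ ?(MN Mm) // groupJr ?(MK Mm). Qed.

(** Some [u ^ r] falls outside [B], hence in the cell of some [r * h]; stripping its factors in [U]
    leaves a monomial element of [K r]. *)
Lemma monom_nonempty r : r \in R -> exists2 u, u \in U & u ^ r \notin U /\ exists m, m \in M r.
Proof.
move=> Rr; have Nr := reflN Rr.
have [u Uu nBu] : exists2 u, u \in U & u ^ r \notin B.
  have [b Bb] := refl_unstable Rr; have [u [h [Uu Hh ->]]] := BUH Bb => nB.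
  exists u => //; apply: contra nB => Bu.
  have -> : r * (u * h) * r = (r * r) * (u ^ r * h ^ r).
    by rewrite -conjMg conjgE !mulgA mulgK.
  by apply: groupM; [apply/HB/refl_sqr | apply: groupM; rewrite // HB ?HJ].
exists u => //; split; first by apply: contra nBu => /UB.
have [Bu|] := parab_cells Rr (UJK r Uu); first by rewrite Bu in nBu.
case/(cell_split Nr)=> h Hh /dcosetP[a [b [Ua Ub e]]]; exists (r * h).
have e' : r * h = a^-1 * u ^ r * b^-1 by rewrite e !mulgA mulVg mul1g mulgK.
rewrite !inE groupMr // reflNH //= (groupM Nr (HN Hh)) /= e'.
by apply: groupM; [apply: groupM|]; rewrite ?groupV; [apply: UK | apply: UJK | apply: UK].
Qed.

Lemma monomJ r m h : r \in R -> m \in M r -> h \in H -> m ^ h \in M r.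
Proof.
move=> Rr Mm Hh; have /setDP[/setIP[Nm Km] nHm] := Mm.
rewrite !inE groupJr // nHm (groupJ Nm (HN Hh)) /=.
have nUh k : k \in H -> U :^ k = U.
  by move=> Hk; apply/normP/(subsetP (normal_norm nUB))/HB.
have <- : K r :^ h = K r; last by rewrite memJ_conjg.
rewrite /= -genJ conjUg -conjsgM nUh //; congr <<_ :|: _>>.
have -> : r * h = (r * h * r^-1) * r by rewrite mulgKV.
by rewrite conjsgM nUh // HJV // reflN.
Qed.

Lemma parab_split r m g : r \in R -> m \in M r -> g \in K r ->
  g \in U * T r \/ exists2 k, k \in T r & g \in E (m * k).
Proof.
move=> Rr Mm Kg; have Nm := MN Mm; have [Bg|] := parab_cells Rr Kg.
  left; have [u [k [Uu Hk e]]] := BUH Bg; rewrite e mem_mulg // inE Hk.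
  by rewrite -(groupMl _ (UK r Uu)) -e.
have rm : r \in C m.
  apply: cell_inH => //.
  by rewrite -groupV invMg invgK; apply: monomH.
move/(dcoset_trans rm); case/(cell_split Nm)=> k Hk /dcosetP[a [b [Ua Ub e]]].
right; exists k; last by apply/dcosetP; exists a, b.
have e' : k = m^-1 * a^-1 * g * b^-1 by rewrite e !mulgA mulgK mulgKV mulVg mul1g.
have Km := MK Mm; have Ka := UK r Ua; have Kb := UK r Ub.
by rewrite inE Hk /= e'; mem.
Qed.

Lemma rank_one r m h : r \in R -> m \in M r -> h \in T r ->
  exists2 u, u \in U & m * u * m \in E (m * h).
Proof.
move=> Rr Mm; have Nm := MN Mm; have Rm := monom_refl Rr Mm.
apply: (rank_one_surj (p := p) (K := K r)) => //.
- exact: abelianS (subsetIl _ _) cHH.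
- exact: pgroupS (subsetIl _ _) pH.
- by apply/subsetP=> k /TH/HB Bk; apply: (subsetP (normal_norm nUB)).
- by apply/normP/setP=> x; rewrite mem_conjg -(torusJ _ Mm) conjgKV.
- exact: (monomM_torus Rr Mm Mm).
- exact: MK.
- exact: subsetIr.
- by rewrite -(parab_monom Rr Mm).
- by move=> g Kg; apply: (parab_split Rr Mm Kg).
- move=> k Tk; apply/negP=> /mulsgP[u k' Uu Tk' e].
  have : m * k \in B by rewrite e; apply: groupM (UB Uu) (HB (TH Tk')).
  move=> Bmk; have Hk := TH Tk; case/setDP: Mm => _ /negP[].
  by rewrite -(groupMr _ Hk); apply: BNH => //; mem.
- move=> k k' Tk Tk' /dcosetU_inj inj; apply: (mulgI m); apply: inj.
    exact: groupM Nm (HN (TH Tk)).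
  exact: groupM Nm (HN (TH Tk')).
- have [u Uu [nU _]] := monom_nonempty Rm.
  by exists u.
Qed.

Lemma monomHr r m : r \in R -> m \in M r -> m * r^-1 \in H.
Proof.
move=> Rr Mm; have -> : m * r^-1 = r * (r^-1 * m) * r^-1 by rewrite mulKVg.
by apply: HJV; [apply: reflN | apply: monomH].
Qed.

Lemma len_monom r m n : r \in R -> m \in M r -> n \in N -> len (m * n) = len (r * n).
Proof.
move=> Rr Mm Nn; have -> : m * n = (m * r^-1) * (r * n) by rewrite !mulgA mulgKV.
by apply: lenMl; [apply: monomHr | mem].
Qed.

Let monom_descent r m n k : r \in R -> m \in M r -> k \in T r -> n \in N ->
  len (r * n) < len n -> len (m^-1 * n) < len (m * k * (m^-1 * n)).
Proof.
move=> Rr Mm Tk Nn lt; have Nm := MN Mm; have Hk := TH Tk.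
have -> : m * k * (m^-1 * n) = (m * k * m^-1) * n by rewrite !mulgA.
rewrite lenMl ?HJV // len_reflV ?(monom_refl Rr Mm) //.
by rewrite (len_monom Rr).
Qed.

(** Factor [m * u * n] as [(m * u * m) * (m^-1 * n)]. The first factor is in [K r], where two kinds
    of cell exist, and [m] lengthens the second, so cells multiply. *)
Lemma monom_dec r m n u : r \in R -> m \in M r -> n \in N -> u \in U ->
  len (r * n) < len n ->
  exists2 h, h \in T r & m * u * n \in E (h * (m * n)) \/ m * u * n \in E (h * n).
Proof.
move=> Rr Mm Nn Uu lt; have Nm := MN Mm; have Km := MK Mm; have Kr := UK r Uu.
have -> : m * u * n = (m * u * m) * (m^-1 * n) by rewrite !mulgA mulgK.
have Kg : m * u * m \in K r by rewrite !groupM.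
have [/mulsgP[v k Uv Tk ->]|[k Tk gk]] := parab_split Rr Mm Kg.
  exists (k * (m * m)^-1); first by rewrite groupM ?groupV ?(monomM_torus Rr).
  left; have -> : k * (m * m)^-1 * (m * n) = k * (m^-1 * n) by rewrite invMg !mulgA mulgKV.
  by rewrite -mulgA mem_dcosetl // dcoset_id.
exists (k ^ m^-1).
  by rewrite -(torusJ _ Mm) conjgKV.
right; have -> : k ^ m^-1 * n = m * k * (m^-1 * n) by rewrite conjgE invgK !mulgA.
apply: dcosetUM => //; last exact: dcoset_id.
- exact/(monom_refl Rr)/monomMr.
- by mem.
- exact: (monom_descent Rr).
Qed.

Lemma monom_dec_surj r m n h : r \in R -> m \in M r -> n \in N -> h \in T r ->
  len (r * n) < len n -> exists2 u, u \in U & m * u * n \in E (h * n).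
Proof.
move=> Rr Mm Nn Th lt; have Nm := MN Mm.
(* The cell to aim at is that of [m * h ^ m], because [m * h ^ m * m^-1] is [h]. *)
have Tk : h ^ m \in T r by rewrite torusJ.
have [u Uu gu] := rank_one Rr Mm Tk; exists u => //.
have -> : m * u * n = (m * u * m) * (m^-1 * n) by rewrite !mulgA mulgK.
have -> : h * n = m * h ^ m * (m^-1 * n) by rewrite conjgE !mulgA mulgV mul1g mulgK.
apply: dcosetUM => //; last exact: dcoset_id.
- exact/(monom_refl Rr)/monomMr.
- by mem.
- exact: (monom_descent Rr).
Qed.

(* Choose u with m u m^-1 in E(m); then m u m^-1 x lies in E(m x), and writing
   m^-1 x = x (m^x)^-1 it also lies in E(x) E(m^x) E((m^x)^-1). *)
Lemma monom_conj r t x m : r \in R -> t \in R -> x \in N -> len x < len (r * x) ->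
  (x * t)^-1 * (r * x) \in H -> m \in M r -> m ^ x \in M t.
Proof.
move=> Rr Rt Nx lt Hh Mm; have Nm := MN Mm; have Rm := monom_refl Rr Mm.
have Nr := reflN Rr; have Nt := reflN Rt.
pose t0 := m ^ x; have Nt0 : t0 \in N by rewrite groupJ.
have Ht0 : t^-1 * t0 \in H.
  have -> : t^-1 * t0 = ((x * t)^-1 * (r * x)) * (r^-1 * m) ^ x.
    by rewrite /t0 !conjgE !invMg !mulgA !mulgK.
  by apply: groupM; rewrite // HJ // monomH.
have Rt0 : t0 \in R by rewrite -[t0](mulKVg t) reflMr.
have mx : m * x = x * t0 by rewrite /t0 conjgE mulKVg.
have mVx : m^-1 * x = x * t0^-1 by rewrite /t0 conjgE !invMg invgK !mulgA mulgV mul1g.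
have lmx : len x < len (m * x) by rewrite (len_monom Rr).
(* Aiming at the torus element [m * m] lets it be divided out on the right, which turns [m * u * m]
   into [m * u * m^-1] in [E m]. *)
have [u Uu hu] := rank_one Rr Mm (monomM_torus Rr Mm Mm).
have h1 : m * u * m^-1 * x \in E (m * x).
  apply: dcosetUM => //; last exact: dcoset_id.
  have e : m * u * m^-1 = m * u * m * (m * m)^-1 by rewrite invMg !mulgA mulgK.
  have m2 := TH (monomM_torus Rr Mm Mm).
  by rewrite e -[m in E m](mulgK (m * m)) dcosetHr ?groupV.
have /dcosetP[a [b [Ua Ub e]]] : m * (u * x) \in E (m * x).
  by apply: dcosetUM; rewrite ?dcoset_id // mem_dcosetl ?dcoset_id.
pose k := b ^ t0^-1.
have Kk : k \in K t.
  have <- : K t0^-1 = K t; last exact: UJK.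
  apply: parab_eq => //; rewrite -groupV invMg !invgK.
  have -> : t0 * t = t0 * t0 * (t^-1 * t0)^-1 by rewrite invMg invgK -(mulgA t0 t0) mulKVg.
  by rewrite groupM ?groupV ?refl_sqr.
have e2 : m * u * m^-1 * x = a * (x * k).
  have -> : m * u * m^-1 * x = m * (u * x) * t0^-1 by rewrite -!mulgA mVx.
  by rewrite e mx /k conjgE invgK !mulgA mulgK.
rewrite e2 mem_dcosetl // in h1.
(* If [k] were in [B] it would be in [U], and [x] would share a cell with the longer [m * x]. *)
have [Bk|ck] := parab_cells Rt Kk.
  have Uk : k \in U by apply: pelt.
  move: h1; rewrite mem_dcosetr // => /dcoset_UB/(cell_len (groupM Nm Nx) Nx) l.
  by rewrite l ltnn in lmx.
have [n1 Hn1 /dcosetP[c [d [Uc Ud ek]]]] := cell_split Nt ck.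
have Mn1 : t * n1 \in M t.
  have e3 : t * n1 = c^-1 * k * d^-1 by rewrite ek !mulgA mulVg mul1g mulgK.
  rewrite !inE reflNH ?reflMr //= (groupM Nt (HN Hn1)) e3 /=.
  by have Kc := UK t Uc; have Kd := UK t Ud; mem.
have l1 : len (x * (t * n1)) = len (m * x).
  have -> : x * (t * n1) = m * x * ((t^-1 * t0)^-1 * n1).
    by rewrite mx invMg invgK -(mulgA t0^-1 t) -(mulgA x t0) mulKVg.
  by apply: lenMr; [rewrite groupM ?groupV | mem].
have Nn1 := groupM Nt (HN Hn1).
(* Since [x * k] is also in [E (m * x)], uniqueness of the cell identifies [m ^ x] with [t * n1]. *)
have h2 : x * k \in E (x * (t * n1)).
  apply: dcosetUMr; rewrite ?reflMr ?l1 ?dcoset_id //.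
  by apply/dcosetP; exists c, d.
have : x * (t * n1) = m * x.
  apply: dcosetU_inj; [mem | mem |].
  by apply: (dcoset_trans h2); rewrite dcoset_sym.
by rewrite mx => /mulgI; rewrite -/t0 => <-.
Qed.

(** * Reduced monomial words and the tori they collect *)

Definition torus0 : {group gT} := <<\bigcup_(r in R) T r>>%G.

(* [red k n J]: n = b m_1 ... m_k with b in torus0, m_i in M t_i and len n = k;
   J is the product of the T t_i. *)
Inductive red : nat -> gT -> {group gT} -> Prop :=
| red0 b : b \in torus0 -> red 0 b 1%G
| redS k x J t m : red k x J -> t \in R -> m \in M t -> len (x * m) = k.+1 ->
    red k.+1 (x * m) (J <*> T t)%G.

Let T0H h : h \in torus0 -> h \in H.
Proof.
apply/subsetP; rewrite gen_subG; apply/bigcupsP=> r _; exact: subsetIl.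
Qed.

Let TT0 r h : r \in R -> h \in T r -> h \in torus0.
Proof. by move=> Rr Th; rewrite mem_gen //; apply/bigcupP; exists r. Qed.

Lemma red_N k x J : red k x J -> x \in N.
Proof.
elim=> [b /T0H Hb|k' x' J' t m _ Nx _ /MN Nm _]; by mem.
Qed.

Lemma red_len k x J : red k x J -> len x = k.
Proof.
case=> // b /T0H Hb; apply/eqP; rewrite len_eq0 //; exact: HN.
Qed.

Lemma redT0 k x J : red k x J -> J \subset torus0.
Proof.
elim=> [b _|k' x' J' t m _ sJ Rt _ _]; first exact: sub1G.
by rewrite join_subG sJ; apply/subsetP=> h; apply: TT0.
Qed.

Lemma monom_comm r m h : r \in R -> m \in M r -> h \in H -> h^-1 * (m * h * m^-1) \in T r.
Proof.
move=> Rr Mm Hh; have Hh' := groupVr Hh.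
have := monom_torus Rr Mm (monomJ Rr Mm Hh).
have -> : h^-1 * (m * h * m^-1) = (m^-1 * m ^ h) ^ m^-1.
  by rewrite !conjgE invgK !mulgA mulgV mul1g.
by rewrite -[in X in _ -> X](torusJ _ Mm) conjgKV.
Qed.

(** Moving an element of [H] past one factor in [M t] changes it by an element of [T t]. *)
Lemma red_comm k x J h : red k x J -> h \in H -> h^-1 * (x * h * x^-1) \in J.
Proof.
move=> rx; elim: rx h => [b /T0H Hb|k' x' J' t m rx IH Rt Mm lxm] h Hh.
  by rewrite (centsP cHH b Hb h Hh) mulgK mulVg group1.
have Th := monom_comm Rt Mm Hh; set j := _ * _ in Th.
have ej : m * h * m^-1 = h * j by rewrite mulKVg.
have Hj := TH Th; have Jx := IH _ (groupM Hh Hj).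
have -> : h^-1 * (x' * m * h * (x' * m)^-1) = j * ((h * j)^-1 * (x' * (h * j) * x'^-1)).
  by rewrite [(h * j)^-1]invMg -(mulgA j^-1) mulKVg -ej invMg !mulgA.
by apply: groupM; [apply: (subsetP (joing_subr _ _)) | apply: (subsetP (joing_subl _ _))].
Qed.

Lemma red_mulH0 b k x J : b \in torus0 -> red k x J -> red k (b * x) J.
Proof.
move=> Tb; elim=> [c Tc|k' x' J' t m rx IH Rt Mm lxm]; first by apply: red0; apply: groupM.
rewrite mulgA; apply: redS => //; rewrite -mulgA lenMl ?T0H //.
by have Nx := red_N rx; have Nm := MN Mm; mem.
Qed.

(** The exchange condition with the torus part under control. Either [r] already shortens the prefix
    [x], or [M r] is carried by conjugation by [x] into [M t], where [t] is the last reflection of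
    the word. *)
Lemma red_dec k n J r : red k n J -> r \in R -> len (r * n) < len n ->
  T r \subset J /\ forall m, m \in M r -> exists J', red k.-1 (m * n) J'.
Proof.
move=> rn Rr; elim: rn => [b Tb|k' x J' t m' rx IH Rt Mm' lxm] lt.
  by move: lt; rewrite (eqP (_ : len b == 0)) // len_eq0 ?HN ?T0H.
have Nx := red_N rx; have Nm' := MN Mm'; have Nr := reflN Rr; have lx := red_len rx.
have Rm' := monom_refl Rt Mm'.
have [l1|l1] := len_reflP Rr Nx; last first.
  have [|sT red'] := IH; first by rewrite l1.
  split; first exact: subset_trans sT (joing_subl _ _).
  move=> m Mm; have [J2 r2] := red' m Mm.
  (* [k'] is positive because [r] shortens [x]; only then does appending [m'] restore the index
     [k']. *)
  case: k' lx rx lxm IH red' r2 => [|k'] lx rx lxm IH red' r2; first by rewrite l1 in lx.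
  exists (J2 <*> T t)%G; rewrite mulgA; apply: redS => //.
  rewrite -mulgA (len_monom Rr) //; last by mem.
  have [|] := len_reflP Rr (groupM Nx Nm'); first by move=> e; rewrite e ltnNge leqnSn in lt.
  by rewrite lxm => -[].
have lt1 : len x < len (r * x) by rewrite l1.
have Hh := fold_exchange Rr Rm' Nx lt1 lt.
have Hh' : (x * t)^-1 * (r * x) \in H.
  have -> : (x * t)^-1 * (r * x) = (t^-1 * m') * ((x * m')^-1 * (r * x)).
    by rewrite !invMg !mulgA mulgK.
  by apply: groupM; rewrite // monomH.
have conjM m : m \in M r -> m ^ x \in M t by apply: monom_conj.
split.
  (* The elements [m ^ x] and [(m * h) ^ x] of [M t] have quotient [h ^ x] in [T t], and [red_comm]
     relates [h ^ x] to [h] modulo the torus of [x]. *)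
  apply/subsetP=> h Th; have [_ _ [_ [m Mm]]] := monom_nonempty Rr.
  have := monom_torus Rt (conjM _ Mm) (conjM _ (monomMr Mm Th)).
  rewrite -conjVg -conjMg mulKg => Th'.
  have := red_comm rx (TH Th').
  have -> : x * h ^ x * x^-1 = h by rewrite conjgE mulKVg mulgK.
  move=> Jh; rewrite -[h](mulKVg (h ^ x)); apply: groupM.
    exact: (subsetP (joing_subr _ _)).
  exact: (subsetP (joing_subl _ _)).
(* Here [m] cancels [m'] up to a torus element, so the word of [x] serves after changing its
   head. *)
move=> m Mm; exists J'; rewrite /=.
have Tk := monomM_torus Rt (conjM _ Mm) Mm'.
have -> : m * (x * m') = (m ^ x * m') ^ x^-1 * x.
  by rewrite !conjgE invgK !mulgA mulgV mul1g mulgKV.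
apply: red_mulH0 => //; rewrite -[_ ^ _](mulKVg (m ^ x * m')); apply: groupM.
  exact: TT0 Tk.
apply: (subsetP (redT0 rx)); have := red_comm rx (TH Tk).
by move: (m ^ x * m') => y; rewrite conjgE invgK !mulgA.
Qed.

(** Words grow on the right, so a new first letter is carried inward by induction down to the torus
    element at the head. *)
Lemma red_inc k n J r m : red k n J -> r \in R -> m \in M r -> len n < len (r * n) ->
  exists J', red k.+1 (m * n) J'.
Proof.
move=> rn Rr Mm; have Nm := MN Mm; elim: rn => [b Tb|k' x J' t m' rx IH Rt Mm' lxm] lt.
  have Hb := T0H Tb; exists (1%G <*> T r)%G.
  have -> : m * b = (m * b * m^-1) * m by rewrite mulgKV.
  have l0 : len b = 0 by apply/eqP; rewrite len_eq0 ?HN.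
  apply: (@redS 0) => //.
    apply: red0; rewrite -[_ * _ * _](mulKVg b); apply: groupM => //.
    exact/(TT0 Rr)/monom_comm.
  rewrite mulgKV (len_monom Rr) //; apply/eqP; rewrite eqn_leq -{2}l0 lt andbT -l0.
  by apply: len_reflM => //; apply: HN.
have Nx := red_N rx; have Nm' := MN Mm'; have Nr := reflN Rr; have lx := red_len rx.
have Rm' := monom_refl Rt Mm'.
have [e|e] := len_reflP Rr (groupM Nx Nm'); last by rewrite e ltnNge leqnSn in lt.
have lt1 : len x < len (r * x).
  have := len_Mrefl Rm' (groupM Nr Nx); rewrite -mulgA e lxm lx ltnS //.
have [J2 r2] := IH lt1.
exists (J2 <*> T t)%G; rewrite mulgA; apply: redS => //.
rewrite -mulgA (len_monom Rr) //; last by mem.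
by rewrite e lxm.
Qed.

(** * Simplicity of [G] and generation of [H] by the rank one tori *)

Hypotheses (simG : simple G) (pBG : B \proper G).

Lemma refl_nonempty : R != set0.
Proof.
apply/negP=> /eqP R0; case/properP: pBG => _ [g Gg nBg].
have [n Nn /dcosetP[b [b' [Bb Bb' e]]]] := bruhat Gg.
have Hn : n \in H.
  rewrite -len_eq0 // -leqn0 leqNgt; apply/negP=> /(len_descent Nn)[r].
  by rewrite R0 inE.
by case/negP: nBg; rewrite e; mem.
Qed.

Let GU : {group gT} := <<U :|: \bigcup_(r in R) M r>>%G.

Let MGU r m : r \in R -> m \in M r -> m \in GU.
Proof.
by move=> Rr Mm; rewrite mem_gen // inE; apply/orP; right; apply/bigcupP; exists r.
Qed.

Let HnormGU h : h \in H -> h \in 'N(GU).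
Proof.
suff hh k : k \in H -> GU :^ k \subset GU by move=> Hh; rewrite inE hh.
move=> Hk; rewrite -genJ gen_subG; apply/subsetP=> x; rewrite mem_conjg inE.
rewrite -[x in X in _ -> X](conjgKV k); move: (x ^ k^-1) => y /orP[Uy|].
  by rewrite mem_gen // inE UJ ?HB ?Uy.
by case/bigcupP=> r Rr My; apply: (MGU Rr); apply: monomJ.
Qed.

Let NnormGU n : n \in N -> n \in 'N(GU).
Proof.
have [k] := ubnP (len n); elim: k n => // k IH n lk Nn.
have [l0|/(len_descent Nn)[r Rr lr]] := posnP (len n).
  by apply: HnormGU; rewrite -len_eq0 // l0.
have Nr := reflN Rr; have [_ _ [_ [m Mm]]] := monom_nonempty Rr.
have nm : m \in 'N(GU) := subsetP (normG GU) m (MGU Rr Mm).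
have -> : n = r^-1 * (r * n) by rewrite mulKg.
apply: groupM; last by apply: IH; [rewrite -ltnS -lr | mem].
rewrite groupV -(groupMl _ (HnormGU (monomHr Rr Mm))) mulgKV //.
Qed.

(** [GU] contains [U] and is normalized by [H] and [N], hence is normal in [G]; it is nontrivial
    because some reflection moves an element of [U] out of [U]. *)
Let GU_G : GU = G.
Proof.
have sGU : GU \subset G.
  rewrite gen_subG; apply/subsetP=> x; rewrite inE => /orP[/UB/BG//|].
  by case/bigcupP=> r _ /MN/NG.
have nGU : GU <| G.
  rewrite /normal sGU genG gen_subG; apply/subsetP=> x; rewrite inE => /orP[|/NnormGU//].
  case/BUH=> u [h [Uu Hh ->]]; apply: groupM; last exact: HnormGU.
  by apply: (subsetP (normG GU)); rewrite mem_gen // inE Uu.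
have [_ sim] := simpleP _ simG; have [GU1|] := sim GU nGU; last exact: val_inj.
have [r Rr] := set0Pn _ refl_nonempty; have [u Uu [nU _]] := monom_nonempty Rr.
have : u \in GU by rewrite mem_gen // inE Uu.
by rewrite GU1 => /set1P u1; rewrite u1 conj1g group1 in nU.
Qed.

(** The union of the cells of reduced words is stable under left multiplication by the generators of
    [GU], so it is all of [G]; uniqueness of the cell then returns [n] itself. *)
Lemma red_all n : n \in N -> exists k J, red k n J.
Proof.
move=> Nn; have : n \in GU by rewrite GU_G NG.
suff hh g : g \in GU -> exists n' k J, red k n' J /\ g \in E n'.
  case/hh=> n' [k [J [rn' nn']]]; exists k, J.
  by rewrite -(dcosetU_inj (red_N rn') Nn nn').
case/gen_prodgP=> l [c cU ->]; elim: l c cU => [|l IH] c cU.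
  by rewrite big_ord0; exists 1, 0, 1%G; split; [apply: red0 | apply: dcoset_id].
rewrite big_ord_recl.
have [n' [k [J [rn' gn']]]] := IH (fun i => c (lift ord0 i)) (fun i => cU _).
move: (\prod_(i < l) _) gn' => y yn'; have Nn' := red_N rn'.
have := cU ord0; rewrite inE => /orP[Uc|/bigcupP[r Rr Mc]].
  by exists n', k, J; rewrite mem_dcosetl.
move: (c ord0) Mc => m Mm; have Nm := MN Mm; have Rm := monom_refl Rr Mm.
have [lt|lt] := len_reflP Rr Nn'.
  have [J' r'] : exists J', red k.+1 (m * n') J'.
    by apply: (red_inc rn' Rr Mm); rewrite lt.
  exists (m * n'), k.+1, J'; split=> //; apply: dcosetUM; rewrite ?dcoset_id //.
  by rewrite (len_monom Rr) // lt.
have {}lt : len (r * n') < len n' by rewrite lt.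
case/dcosetP: yn' => a [b [Ua Ub ->]].
have [h Th hh] := monom_dec Rr Mm Nn' Ua lt.
have -> : m * (a * n' * b) = m * a * n' * b by rewrite !mulgA.
have T0h := TT0 Rr Th.
case: hh => hh.
  have [_ /(_ m Mm)[J' r']] := red_dec rn' Rr lt.
  by exists (h * (m * n')), k.-1, J'; split; [apply: red_mulH0 | rewrite mem_dcosetr].
by exists (h * n'), k, J; split; [apply: red_mulH0 | rewrite mem_dcosetr].
Qed.

(** An element of length 0 can only come from the empty word, which consists of its head in
    [torus0]. *)
Lemma H_torus0 h : h \in H -> h \in torus0.
Proof.
move=> Hh; have [k [J rh]] := red_all (HN Hh).
have /eqP l0 : len h == 0 by rewrite len_eq0 // HN.
by have := red_len rh; rewrite l0 => k0; rewrite -k0 in rh; inversion rh.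
Qed.

Lemma mem_dcosetM x y g g' : g \in E x * E y -> g' \in E g -> g' \in E x * E y.
Proof.
case/mulsgP=> a b Ea Eb -> /dcosetP[c [d [Uc Ud ->]]].
have -> : c * (a * b) * d = (c * a) * (b * d) by rewrite !mulgA.
by apply: mem_mulg; [rewrite mem_dcosetl | rewrite mem_dcosetr].
Qed.

(** * The longest element and the factorizations of [G] *)

Definition len_max n0 := n0 \in N /\ forall n, n \in N -> len n <= len n0.

Lemma len_maxV n0 : len_max n0 -> len_max n0^-1.
Proof.
by case=> Nn0 lm; split; rewrite ?groupV // => n Nn; rewrite lenV // lm.
Qed.

Lemma len_max_lt n0 z r : len_max n0 -> z \in H -> r \in R -> len (r * (z * n0)) < len (z * n0).
Proof.
case=> Nn0 lm Hz Rr; have Nr := reflN Rr; have Nz := groupM (HN Hz) Nn0.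
have [e|->//] := len_reflP Rr Nz.
have := lm _ (groupM Nr Nz); rewrite e lenMl // ltnn //.
Qed.

(** Every reflection shortens [z * n0], so by [monom_dec_surj] each letter of the word absorbs its
    whole torus; [b] is the head of the word. *)
Lemma red_absorb n0 k x J : len_max n0 -> red k x J ->
  exists2 b, b \in H & forall z j, z \in H -> j \in J -> b * j * (z * n0) \in E x * E (z * n0).
Proof.
move=> lm; have [Nn0 _] := lm; elim=> [c /T0H Hc|k' x' J' t m rx [b Hb IH] Rt Mm lxm].
  by exists c => // z j Hz /set1P->; rewrite mulg1 mem_mulg ?dcoset_id.
exists b => // z j Hz.
have cJT : T t \subset 'C(J').
  apply: subset_trans (subset_trans (subsetIl _ _) cHH) (centS _).
  by apply/subsetP=> y /(subsetP (redT0 rx)); apply: T0H.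
rewrite /= cent_joinEr // => /mulsgP[j1 j2 J1 T2 ->].
have H2 := TH T2; have Nz := groupM (HN Hz) Nn0; have Nx := red_N rx.
have [u Uu hu] := monom_dec_surj Rt Mm Nz T2 (len_max_lt lm Hz Rt).
have -> : b * (j1 * j2) * (z * n0) = b * j1 * (j2 * z * n0) by rewrite !mulgA.
(* The part [j2] due to the last letter is handed to the induction inside [z], which is why [z] is
   left free. *)
have /mulsgP[g g' Eg Eg' ->] := IH (j2 * z) j1 (groupM H2 Hz) J1.
have : g' \in E m * E (z * n0).
  apply: (@mem_dcosetM _ _ (j2 * z * n0)) => //.
  rewrite -(mulgA j2); apply: (@mem_dcosetM _ _ (m * u * (z * n0))).
    by apply: mem_mulg; [rewrite mem_dcosetr // dcoset_id | apply: dcoset_id].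
  by rewrite dcoset_sym.
case/mulsgP=> y y' Ey Ey' ->; rewrite (mulgA g); apply: mem_mulg => //.
apply: dcosetUMr => //; first exact: monom_refl Mm.
by rewrite lxm (red_len rx).
Qed.

(** Every reflection shortens [n0^-1], so by [red_dec] the torus of its word contains every [T r],
    hence all of [H]. *)
Lemma H_longest n0 h : len_max n0 -> h \in H -> h * n0 \in E n0^-1 * E n0.
Proof.
move=> lm Hh; have [Nn0 _] := lm; have lmV := len_maxV lm.
have [k [J rn]] := red_all (groupVr Nn0).
have sJ : torus0 \subset J.
  rewrite gen_subG; apply/bigcupsP=> r Rr.
  have := len_max_lt lmV (group1 H) Rr; rewrite mul1g => lt.
  by have [] := red_dec rn Rr lt.
have [b Hb hb] := red_absorb lm rn.
have Hbh : b^-1 * h \in H by rewrite groupM ?groupV.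
have := hb 1 (b^-1 * h) (group1 H) (subsetP sJ _ (H_torus0 Hbh)).
by rewrite mul1g mulKVg.
Qed.

(** Build [g] along a reduced expression of [n]: each reflection shortens [n1], so [cell_len_gt]
    offers an element of [B] whose insertion keeps the product in [C n1]. *)
Lemma cell_longest n1 n : len_max n1 -> n \in N -> exists2 g, g \in C n & g * n1 \in C n1.
Proof.
move=> lm; have [Nn1 _] := lm; have [k] := ubnP (len n); elim: k n => // k IH n lk Nn.
have [l0|/(len_descent Nn)[r Rr lr]] := posnP (len n).
  have Hn : n \in H by rewrite -len_eq0 // l0.
  by exists n; rewrite ?dcoset_id // mem_dcosetl ?dcoset_id // HB.
have Nr := reflN Rr; have Nrn := groupM Nr Nn; have RV := reflV Rr.
have [g gn /dcosetP[c [c' [Bc Bc' e]]]] : exists2 g, g \in C (r * n) & g * n1 \in C n1.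
  by apply: IH => //; rewrite -ltnS -lr.
have := len_max_lt lm (group1 H) RV; rewrite mul1g => lt.
have [b Bb hb] := cell_len_gt RV Nn1 lt.
exists (r^-1 * (b * c^-1) * g).
  case/dcosetP: gn => d [d' [Bd Bd' ->]].
  have -> : r^-1 * (b * c^-1) * (d * (r * n) * d') = r^-1 * (b * c^-1 * d) * (r * n) * d'.
    by rewrite !mulgA.
  rewrite mem_dcosetr // -[n in C n](mulKg r); apply: cell_len_le => //; first by mem.
  by rewrite mulKg lr.
have -> : r^-1 * (b * c^-1) * g * n1 = r^-1 * b * n1 * c'.
  by rewrite -(mulgA _ g) e !mulgA mulgKV.
by rewrite mem_dcosetr.
Qed.

Lemma N_longest n1 n : len_max n1 -> n \in N ->
  exists2 h, h \in H & n \in E (n1 * h) * E n1^-1.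
Proof.
move=> lm Nn; have [Nn1 _] := lm; have [g gn gn1] := cell_longest lm Nn.
rewrite dcoset_sym in gn; case/dcosetP: gn => b [b' [Bb + e]].
rewrite -groupV => /BUH[u [h [Uu Hh /(canRL invgK) e']]].
have Hk : h^-1 ^ n1 \in H by rewrite HJ // groupV.
have : b * (g * n1) * h^-1 ^ n1 \in C n1 by rewrite mem_dcosetr ?HB // mem_dcosetl.
case/(cell_split Nn1)=> k Hk' hk; exists k => //.
have -> : n = b * (g * n1) * h^-1 ^ n1 * (n1^-1 * u^-1).
  by rewrite e e' conjgE invMg !mulgA !mulgK.
by rewrite mem_mulg // mem_dcosetr ?groupV // dcoset_id.
Qed.

Lemma G_cover g (X : {set gT}) : g \in G ->
  (forall n, n \in N -> n \in X) -> (forall x y, x \in X -> y \in E x -> y \in X) -> g \in X.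
Proof. by case/bruhatU=> n Nn gn NX EX; apply: EX gn; apply: NX. Qed.

Lemma dcosetU_G x : x \in G -> E x \subset G.
Proof.
move=> Gx; apply/subsetP=> y /dcosetP[a [b [Ua Ub ->]]].
by rewrite !groupM // ?(BG (UB Ua)) ?(BG (UB Ub)).
Qed.

Lemma conjU_prod4 n0 : n0 \in N ->
  U * U :^ n0 * U * U :^ n0 = E n0^-1 * E n0 * E n0^-1 :* n0.
Proof.
move=> Nn0; rewrite !conjsgE /dcoset !mulgA.
by do 3?rewrite -(mulgA _ U U) mulGid.
Qed.

Lemma conjU_prod3 n0 : U * U :^ n0 * U = E n0^-1 * E n0.
Proof.
rewrite !conjsgE /dcoset !mulgA.
by do 3?rewrite -(mulgA _ U U) mulGid.
Qed.

Lemma G_prod4 n0 : len_max n0 -> (G : {set gT}) = U * U :^ n0 * U * U :^ n0.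
Proof.
move=> lm; have [Nn0 _] := lm; rewrite conjU_prod4 //.
suff -> : E n0^-1 * E n0 * E n0^-1 = G by rewrite rcoset_id // NG.
have GV : n0^-1 \in G by rewrite groupV NG.
have sE := (dcosetU_G GV, dcosetU_G (NG Nn0)).
apply/eqP; rewrite eqEsubset (mul_subG (mul_subG sE.1 sE.2) sE.1) /=.
apply/subsetP=> g Gg; apply: (G_cover Gg) => [n Nn|x y].
  (* [N_longest] leaves an unknown torus factor in the first cell; [H_longest] absorbs it at the
     price of one more cell. *)
  have [h Hh /mulsgP[a b Ea Eb ->]] := N_longest lm Nn; rewrite mem_mulg //.
  apply: mem_dcosetM Ea; have -> : n0 * h = (n0 * h * n0^-1) * n0 by rewrite mulgKV.
  by apply: H_longest => //; apply: HJV.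
case/mulsgP=> a b Ea Eb -> /dcosetP[c [d [Uc Ud ->]]].
have -> : c * (a * b) * d = (c * a) * (b * d) by rewrite !mulgA.
apply: mem_mulg; last by rewrite mem_dcosetr.
by apply: mem_dcosetM Ea _; rewrite mem_dcosetl ?dcoset_id.
Qed.

Lemma G_prod3 n0 : len_max n0 -> H :=: 1 -> (G : {set gT}) = U * U :^ n0 * U.
Proof.
move=> lm H1; have [Nn0 _] := lm; rewrite conjU_prod3.
have GV : n0^-1 \in G by rewrite groupV NG.
have sE := (dcosetU_G GV, dcosetU_G (NG Nn0)).
apply/eqP; rewrite eqEsubset (mul_subG sE.1 sE.2) andbT.
apply/subsetP=> g Gg; apply: (G_cover Gg) => [n Nn|x y xx]; last exact: mem_dcosetM.
have [h] := N_longest (len_maxV lm) Nn.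
by rewrite H1 => /set1P->; rewrite mulg1 invgK.
Qed.

(** The element of [U] between [n] and [n'], conjugated by [n^-1], is a [p]-element of [B]; its
    [H]-component [h * (n * n')^-1] must be 1. *)
Lemma dcosetM_H n n' h : n \in N -> n' \in N -> h \in H -> h \in E n * E n' -> h = n * n'.
Proof.
move=> Nn Nn' Hh /mulsgP[g g' /dcosetP[a [b [Ua Ub ->]]] /dcosetP[c [d [Uc Ud ->]]]] e.
have NV := groupVr Nn.
have Hk : n * n' \in H.
  rewrite -{1}[n]invgK; apply: cell_inj => //; apply/dcosetP.
  exists (b * c)^-1, (a^-1 * h * d^-1); split; [by mem|by mem|].
  by rewrite e invMg !mulgA mulgK !mulgKV mulVg mul1g.
have [k ek] : exists k, k = n * n' by exists (n * n').
rewrite -ek in Hk *.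
have e1 : (b * c) ^ n^-1 = a^-1 * h * d^-1 * k^-1.
  by rewrite ek e conjgE invMg invgK !mulgA mulVg mul1g !mulgK.
have Ubc := groupM Ub Uc.
have : (b * c) ^ n^-1 \in U by apply: pelt; rewrite // e1; mem.
have -> : (b * c) ^ n^-1 = a^-1 * (h * k^-1) * d^-1 ^ k^-1.
  by rewrite e1 conjgE invgK !mulgA mulgKV.
have Udk : d^-1 ^ k^-1 \in U by rewrite UJ ?groupV // HB.
rewrite groupMr // groupMl ?groupV // => /UH1 h1.
by apply/eqP; rewrite eq_mulgV1 h1 // groupM ?groupV.
Qed.

(** * The Carter condition and the least number of factors *)

Lemma dcoset_eq x n : x \in E n -> E x = E n.
Proof.
move=> xn; apply/setP=> y; apply/idP/idP; first exact: dcoset_trans.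
by apply: dcoset_trans; rewrite dcoset_sym.
Qed.

Lemma H_trivial x y : x \in G -> y \in G -> E x * E y = G -> H :=: 1.
Proof.
move=> /bruhatU[n Nn /dcoset_eq->] /bruhatU[n' Nn' /dcoset_eq->] eG.
have hh h : h \in H -> h = n * n'.
  by move=> Hh; apply: dcosetM_H; rewrite // eG NG ?HN.
by apply/trivgP/subsetP=> h Hh; rewrite (hh h) // -(hh 1) ?group1.
Qed.

Lemma dcosetU_neqG x : x \in G -> E x <> G.
Proof.
move=> Gx eG; have [r Rr] := set0Pn _ refl_nonempty; have Nr := reflN Rr.
have E1 : 1 \in E x by rewrite eG group1.
have : r \in E x by rewrite eG NG.
rewrite -(dcoset_eq E1) => /(dcosetU_inj (group1 N) Nr) r1.
by case/negP: (reflNH Rr); rewrite -r1 group1.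
Qed.

(** [H] normalizes [U] and meets it trivially. Conversely, if [H = 1] then [B = U]; an [n]
    normalizing [U] with a descent [r] has [r * b * n] in [C (r * n)] for every [b] in [B], against
    [cell_len_gt]. *)
Lemma carterP : carter G U <-> H :=: 1.
Proof.
have sUG : U \subset G by apply/subsetP=> u /UB/BG.
split=> [[_ _ NU]|H1].
  apply/trivgP/subsetP=> h Hh; apply/set1P; apply: UH1 => //.
  rewrite -NU inE (BG (HB Hh)) /=.
  exact: (subsetP (normal_norm nUB)) (HB Hh).
split=> //; first exact: pgroup_nil pU.
apply/eqP; rewrite eqEsubset subsetI sUG normG !andbT.
have BU : B :=: U by rewrite -defB H1 mulg1.
apply/subsetP=> g /setIP[/bruhatU[n Nn /dcosetP[a [b [Ua Ub e]]]] nUg].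
have nUn : n \in 'N(U).
  have -> : n = a^-1 * g * b^-1 by rewrite e !mulgA mulVg mul1g mulgK.
  by rewrite !groupM ?groupV // (subsetP (normG U)).
have [l0|/(len_descent Nn)[r Rr lr]] := posnP (len n).
  have : n \in H by rewrite -len_eq0 // l0.
  by rewrite H1 => /set1P n1; rewrite e n1 mulg1 groupM.
have lt : len (r * n) < len n by rewrite lr.
have [b' Bb'] := cell_len_gt Rr Nn lt.
have -> : r * b' * n = r * n * b' ^ n by rewrite conjgE !mulgA mulgK.
rewrite mem_dcosetr ?(negPf (reflM_notcell Rr Nn)) //.
by rewrite BU memJ_norm // -BU.
Qed.

Lemma conj_prod_coverS k : conj_prod_cover G U k -> conj_prod_cover G U k.+1.
Proof.
have sUG : U \subset G by apply/subsetP=> u /UB/BG.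
case=> gs [sz Ggs e]; exists (1 :: gs); split; rewrite /= ?sz ?group1 //.
by rewrite big_cons e conjsg1 mulSGid.
Qed.

Lemma conj_prod_cover_le j k : j <= k -> conj_prod_cover G U j -> conj_prod_cover G U k.
Proof.
move/subnK<-; elim: (k - j) => // d IH /IH; exact: conj_prod_coverS.
Qed.

Let conjU_l a : a *: (U :^ a) = U :* a.
Proof. by rewrite conjsgE lcosetKV. Qed.

Let conjU_r b : U :^ b :* b^-1 = b^-1 *: U.
Proof. by rewrite conjsgE -mulgA rcosetK. Qed.

(** Multiplying by [a] on the left and [b^-1] on the right turns [U :^ a * U :^ b] into one double
    coset of [U]. *)
Lemma conj_prod_cover2 : ~ conj_prod_cover G U 2.
Proof.
case=> -[|a [|b [|? ?]]] [] //= _ /and3P[Ga Gb _].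
rewrite !big_cons big_nil mulg1 => e.
apply: (@dcosetU_neqG (a * b^-1)); first by rewrite groupM ?groupV.
have -> : E (a * b^-1) = a *: (U :^ a * U :^ b) :* b^-1.
  by rewrite mulgA conjU_l -mulgA conjU_r /dcoset -mulg_set1 !mulgA.
by rewrite e lcoset_id // rcoset_id // groupV.
Qed.

(** In the same way three conjugates amount to a product of two double cosets, to which [H_trivial]
    applies. *)
Lemma conj_prod_cover3 : conj_prod_cover G U 3 -> H :=: 1.
Proof.
case=> -[|a [|b [|c [|? ?]]]] [] //= _ /and4P[Ga Gb Gc _].
rewrite !big_cons big_nil mulg1 => e.
apply: (@H_trivial (a * b^-1) (b * c^-1)); rewrite ?groupM ?groupV //.
have -> : E (a * b^-1) * E (b * c^-1) = a *: (U :^ a * (U :^ b * U :^ c)) :* c^-1.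
  rewrite (mulgA [set a]) conjU_l -(mulgA _ (U :^ b * U :^ c)) -(mulgA (U :^ b)) conjU_r.
  rewrite /dcoset -!mulg_set1 conjsgE !mulgA.
  by rewrite -(mulgA _ U U) mulGid.
by rewrite e lcoset_id // rcoset_id // groupV.
Qed.

Lemma longest_len_max n0 : n0 \in N -> longest_elt S (N / H) (coset H n0) -> len_max n0.
Proof.
have hlE w k : has_len S w k <-> w \in S ^+ k.
  split=> [[ss [<- + ->]]|].
    elim: ss => [_|s ss IH /= /andP[Ss /IH h]]; first by rewrite big_nil inE.
    by rewrite big_cons expgS mem_mulg.
  elim: k w => [|k IH] w; first by rewrite expg0 => /set1P->; exists [::]; rewrite big_nil.
  rewrite expgS => /mulsgP[s v Ss /IH[ss [<- Sss ->]] ->].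
  by exists (s :: ss); rewrite /= Ss Sss big_cons.
move=> Nn0 [_ [L [_ minL maxL]]]; split=> // n Nn.
have [k kL /hlE Sk] := maxL (coset H n) (mem_quotient H Nn).
apply: leq_trans (len_expS Nn Sk) (leq_trans kL _).
rewrite leqNgt; apply/negP=> /minL; apply; apply/hlE; exact: expS_len.
Qed.

End SplitBNPair.

Theorem theorem1 (gT : finGroupType) (p : nat) (G B N H U : {group gT})
    (S : {set coset_of H}) (n0 : gT) :
  prime p -> simple G -> split_BN_pair p G B N H U S -> B \proper G ->
  p.-Sylow(G) U -> n0 \in N -> longest_elt S (N / H) (coset H n0) ->
  [/\ (G : {set gT}) = U * (U :^ n0) * U * (U :^ n0),
      (G : {set gT}) = U * (U :^ n0) * U <-> carter G U
    & (carter G U -> min_conj_prod G U 3) /\ (~ carter G U -> min_conj_prod G U 4)].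
Proof.
move=> pr_p simG BNp pBG _ Nn0 longest; have lm := longest_len_max BNp Nn0 longest.
have Gn0 : n0 \in G by have [[-> _ _ _ _] _ _ _ _] := BNp; rewrite mem_gen // inE Nn0 orbT.
have G4 := G_prod4 pr_p simG pBG lm.
have G3 : carter G U -> (G : {set gT}) = U * (U :^ n0) * U.
  by move/(carterP BNp) => H1; exact: (G_prod3 lm H1).
have cover3 : (G : {set gT}) = U * (U :^ n0) * U -> conj_prod_cover G U 3.
  move=> e; exists [:: 1; n0; 1]; split=> //=; first by rewrite group1 Gn0.
  by rewrite !big_cons big_nil mulg1 conjsg1 mulgA -e.
have carter3 : conj_prod_cover G U 3 -> carter G U.
  by move/(conj_prod_cover3 BNp)/(carterP BNp).
split=> //; first by split=> [/cover3/carter3|/G3].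
split=> [/G3/cover3 c3|nc].
  split=> // j j3 cj.
  (* A product with fewer factors can be padded with copies of [U] to exactly two. *)
  exact: (conj_prod_cover2 BNp pBG (conj_prod_cover_le BNp (j3 : j <= 2) cj)).
split=> [|j j4 cj].
  exists [:: 1; n0; 1; n0]; split=> //=; first by rewrite group1 Gn0.
  by rewrite !big_cons big_nil mulg1 conjsg1 !mulgA -G4.
exact: (nc (carter3 (conj_prod_cover_le BNp (j4 : j <= 3) cj))).
Qed.
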